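(* Let $N\in\mathbb N$ (with $N\ge2$ when $R_N=D_N$), $r>0$, $0<t_\ast<\infty$, and $R_N\in\{A_N,B_N,B_N^\vee,C_N,C_N^\vee,BC_N,D_N\}$. For $t\in(0,t_\ast)$ let $\mathbf P^{R_N}_t$ be the probability measure on $S_N^{R_N}$ with density $\mathbf p^{R_N}_t(\mathbf x)=q^{R_N}_t(\mathbf x)/\prod_{n=1}^N m^{R_N}_n(t_\ast)$, where $S_N^{A_N}=\mathbb W_N^{[0,2\pi r)}=\{0\le x_1<\dots<x_N<2\pi r\}$ and $S_N^{R_N}=\mathbb W_N^{[0,\pi r]}=\{0\le x_1<\dots<x_N\le\pi r\}$ for the other six types, and let $\Xi^{R_N}=\sum_{j=1}^N\delta_{X_j}$ where $\mathbf X=(X_1,\dots,X_N)$ has law $\mathbf P^{R_N}_t$. Then, for each $t\in(0,t_\ast)$, $\Xi^{R_N}$ is a determinantal point process (on $[0,2\pi r)$ for $A_N$, on $[0,\pi r]$ otherwise) with correlation kernel \[ K^{R_N}_t(x,y;t_\ast,r)=\sum_{n=1}^N\frac{1}{m^{R_N}_n(t_\ast)}M^{R_N}_n(x,t)\,\overline{M^{R_N}_n(y,t_\ast-t)}, \] i.e. for every $1\le n\le N$ the $n$-point correlation function is $\rho_n(x_1,\dots,x_n)=\det_{1\le j,k\le n}[K^{R_N}_t(x_j,x_k;t_\ast,r)]$.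
   Context: Jacobi theta functions: for $v\in\mathbb C$, $\tau\in\mathbb H=\{\Im\tau>0\}$, $z=e^{\pi iv}$, $q=e^{\pi i\tau}$: $\vartheta_1(v;\tau)=i\sum_{n\in\mathbb Z}(-1)^nq^{(n-1/2)^2}z^{2n-1}$, $\vartheta_2(v;\tau)=\sum_{n\in\mathbb Z}q^{(n-1/2)^2}z^{2n-1}$. For $\sigma\in\mathbb R$, $z\in\mathbb C$, $\tau\in\mathbb H$: $\Theta^A(\sigma,z,\tau)=e^{2\pi i\sigma z}\vartheta_2(\sigma\tau+z;\tau)$, $\Theta^B=e^{2\pi i\sigma z}\vartheta_1(\sigma\tau+z;\tau)-e^{-2\pi i\sigma z}\vartheta_1(\sigma\tau-z;\tau)$, $\Theta^C=e^{2\pi i\sigma z}\vartheta_2(\sigma\tau+z;\tau)-e^{-2\pi i\sigma z}\vartheta_2(\sigma\tau-z;\tau)$, $\Theta^D=e^{2\pi i\sigma z}\vartheta_2(\sigma\tau+z;\tau)+e^{-2\pi i\sigma z}\vartheta_2(\sigma\tau-z;\tau)$. $\sharp(R_N)=A$ for $A_N$, $B$ for $B_N,B_N^\vee$, $C$ for $C_N,C_N^\vee,BC_N$, $D$ for $D_N$; $J^{R_N}(j)=j-1/2$ for $A_N,C_N^\vee$, $j-1$ for $B_N,B_N^\vee,D_N$, $j$ for $C_N,BC_N$; $\mathcal N^{A_N}=N$, $\mathcal N^{B_N}=2N-1$, $\mathcal N^{B_N^\vee}=\mathcal N^{C_N^\vee}=2N$, $\mathcal N^{C_N}=2(N+1)$,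 $\mathcal N^{BC_N}=2N+1$, $\mathcal N^{D_N}=2(N-1)$. $\xi(x)=x/(2\pi r)$, $\tau(t)=it/(2\pi r^2)$; $M^{R_N}_j(x,t)=\Theta^{\sharp(R_N)}\big(J^{R_N}(j)/\mathcal N^{R_N},\mathcal N^{R_N}\xi(x),(\mathcal N^{R_N})^2\tau(t)\big)$. $q^{R_N}_t(\mathbf x)=\det_{j,k}[\overline{M^{R_N}_j(x_k,t_\ast-t)}]\det_{\ell,m}[M^{R_N}_\ell(x_m,t)]$ (nonnegative, and integrating to $\prod_n m^{R_N}_n(t_\ast)$ over $S_N^{R_N}$). Constants: for $A_N,C_N,C_N^\vee,BC_N$: $m^{R_N}_j(t_\ast)=2\pi r\vartheta_2(\mathcal N^{R_N}J^{R_N}(j)\tau(t_\ast);(\mathcal N^{R_N})^2\tau(t_\ast))$; for $B_N,B_N^\vee$: $m_1=4\pi r\vartheta_2(0;(\mathcal N^{R_N})^2\tau(t_\ast))$, $m_j=2\pi r\vartheta_2(\mathcal N^{R_N}J^{R_N}(j)\tau(t_\ast);(\mathcal N^{R_N})^2\tau(t_\ast))$ ($j\ge2$); for $D_N$: $m_1=4\pi r\vartheta_2(0;(\mathcal N^{D_N})^2\tau(t_\ast))$, $m_j=2\pi r\vartheta_2(\mathcal N^{D_N}J^{D_N}(j)\tau(t_\ast);(\mathcal N^{D_N})^2\tau(t_\ast))$ ($2\le j\le N-1$), $m_N=4\pi r\vartheta_2(\mathcal N^{D_N}(N-1)\tau(t_\ast);(\mathcal N^{D_N})^2\tau(t_\ast))$.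 The $n$-point correlation function $\rho_n$ of a point process $\Xi=\sum_j\delta_{X_j}$ is the function with $\mathbb E[\sum_{j_1,\dots,j_n\ \text{distinct}}f(X_{j_1},\dots,X_{j_n})]=\int f(x_1,\dots,x_n)\rho_n(x_1,\dots,x_n)\,dx_1\cdots dx_n$ for all bounded measurable $f$. *)

(* Defs.v *)
(* MathComp + MathComp-Analysis (R : realType), complex numbers R[i]
   from mathcomp-real-closed. *)
From HB Require Import structures.
From mathcomp Require Import all_boot all_order all_algebra.
From mathcomp Require Import all_classical all_reals all_analysis.
From mathcomp Require Import complex.
Unset Printing Implicit Defensive.
Import Order.TTheory GRing.Theory Num.Theory.
Local Open Scope ring_scope.
Local Open Scope complex_scope.

Section Defs.
Variable R : realType.
Local Notation C := R[i].

(* real and imaginary parts *)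
Definition reC (w : C) : R := complex.Re w.
Definition imC (w : C) : R := complex.Im w.

(* complex exponential e^w = e^{Re w} (cos (Im w) + i sin (Im w)) *)
Definition cexp (w : C) : C :=
  (expR (reC w))%:C * (cos (imC w) +i* sin (imC w)).

(* sum over Z of a (absolutely convergent) complex family, as the limit of the
   symmetric partial sums \sum_{-M <= n <= M} u n (real and imaginary parts) *)
Definition zsumR (u : int -> R) : R :=
  limn (fun M : nat => \sum_(k < (2 * M).+1) u (k%:Z - M%:Z)%R).
Definition zsumC (u : int -> C) : C :=
  zsumR (fun n => reC (u n)) +i* zsumR (fun n => imC (u n)).

Definition iC : C := 0 +i* 1.

(* q^{(n-1/2)^2} z^{2n-1} with q = e^{pi i tau}, z = e^{pi i v} *)
Definition theta_term (v tau : C) (n : int) : C :=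
  let a : C := (n%:~R - 2^-1) in
  cexp (pi%:C * iC * tau * a ^+ 2 + pi%:C * iC * v * (2 * a)).

Definition theta1 (v tau : C) : C :=
  iC * zsumC (fun n => (-1) ^ n * theta_term v tau n).
Definition theta2 (v tau : C) : C :=
  zsumC (fun n => theta_term v tau n).

Definition ThetaA (s : R) (z tau : C) : C :=
  cexp (2%:C * pi%:C * iC * s%:C * z) * theta2 (s%:C * tau + z) tau.
Definition ThetaB (s : R) (z tau : C) : C :=
  cexp (2%:C * pi%:C * iC * s%:C * z) * theta1 (s%:C * tau + z) tau
  - cexp (- (2%:C * pi%:C * iC * s%:C * z)) * theta1 (s%:C * tau - z) tau.
Definition ThetaC (s : R) (z tau : C) : C :=
  cexp (2%:C * pi%:C * iC * s%:C * z) * theta2 (s%:C * tau + z) tau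
  - cexp (- (2%:C * pi%:C * iC * s%:C * z)) * theta2 (s%:C * tau - z) tau.
Definition ThetaD (s : R) (z tau : C) : C :=
  cexp (2%:C * pi%:C * iC * s%:C * z) * theta2 (s%:C * tau + z) tau
  + cexp (- (2%:C * pi%:C * iC * s%:C * z)) * theta2 (s%:C * tau - z) tau.

End Defs.

Arguments reC {R}. Arguments imC {R}. Arguments cexp {R}. Arguments zsumR {R}.
Arguments zsumC {R}. Arguments iC {R}. Arguments theta_term {R}.
Arguments theta1 {R}. Arguments theta2 {R}. Arguments ThetaA {R}.
Arguments ThetaB {R}. Arguments ThetaC {R}. Arguments ThetaD {R}.

(* the seven root-system types A_N, B_N, B_N^vee, C_N, C_N^vee, BC_N, D_N *)
Inductive RType := TA | TB | TBv | TC | TCv | TBC | TD.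

Section RS.
Variable R : realType.
Local Notation C := R[i].

Definition ThetaSharp (rt : RType) : R -> C -> C -> C :=
  match rt with
  | TA => ThetaA
  | TB | TBv => ThetaB
  | TC | TCv | TBC => ThetaC
  | TD => ThetaD
  end.

(* J^{R_N}(j) *)
Definition Jr (rt : RType) (j : nat) : R :=
  match rt with
  | TA | TCv => j%:R - 2^-1
  | TB | TBv | TD => j%:R - 1
  | TC | TBC => j%:R
  end.

(* \mathcal N^{R_N} *)
Definition Ncal (rt : RType) (N : nat) : R :=
  match rt with
  | TA => N%:R
  | TB => (2 * N)%:R - 1
  | TBv | TCv => (2 * N)%:R
  | TC => (2 * (N + 1))%:R
  | TBC => (2 * N + 1)%:R
  | TD => (2 * N)%:R - 2
  end.

Definition xi (r x : R) : R := x / (2 * pi * r).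
Definition taut (r t : R) : C := 0 +i* (t / (2 * pi * r ^+ 2)).

Definition Mfun (rt : RType) (N : nat) (r : R) (j : nat) (x t : R) : C :=
  let n := Ncal rt N in
  ThetaSharp rt (Jr rt j / n) (n * xi r x)%:C ((n ^+ 2)%:C * taut r t).

Definition mconst (rt : RType) (N : nat) (r ts : R) (j : nat) : C :=
  let n := Ncal rt N in
  let tau := (n ^+ 2)%:C * taut r ts in
  let gen := (2 * pi * r)%:C * theta2 ((n * Jr rt j)%:C * taut r ts) tau in
  match rt with
  | TA | TC | TCv | TBC => gen
  | TB | TBv =>
      if j == 1%N then (4 * pi * r)%:C * theta2 0 tau else gen
  | TD =>
      if j == 1%N then (4 * pi * r)%:C * theta2 0 tau
      else if j == N then
        (4 * pi * r)%:C * theta2 ((n * (N%:R - 1))%:C * taut r ts) tau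
      else gen
  end.

(* q_t^{R_N}(x) ; indices j = 1..N correspond to i : 'I_N via j = i.+1 *)
Definition qdens (rt : RType) (N : nat) (r ts t : R) (x : N.-tuple R) : C :=
  \det (\matrix_(j < N, k < N) (Mfun rt N r j.+1 (tnth x k) (ts - t))^*)
  * \det (\matrix_(l < N, m < N) Mfun rt N r l.+1 (tnth x m) t).

Definition mprod (rt : RType) (N : nat) (r ts : R) : C :=
  \prod_(n < N) mconst rt N r ts n.+1.

(* the state space S_N^{R_N} *)
Definition upper_ok (rt : RType) (r y : R) : bool :=
  match rt with
  | TA => y < 2 * pi * r
  | _ => y <= pi * r
  end.

Definition SN (rt : RType) (N : nat) (r : R) : set (N.-tuple R) :=
  [set x | (forall i : 'I_N, 0 <= tnth x i /\ upper_ok rt r (tnth x i)) /\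
           (forall i j : 'I_N, (i < j)%N -> tnth x i < tnth x j)].

(* the one-particle space: [0, 2 pi r) for A_N, [0, pi r] otherwise *)
Definition Dom (rt : RType) (r : R) : set R :=
  [set y | 0 <= y /\ upper_ok rt r y].

(* density p_t^{R_N} (zero outside S_N) *)
Definition pdens (rt : RType) (N : nat) (r ts t : R) (x : N.-tuple R) : C :=
  (\1_(SN rt N r) x)%:C * (qdens rt N r ts t x / mprod rt N r ts).

(* correlation kernel K_t^{R_N}(x, y; t_*, r) *)
Definition Kker (rt : RType) (N : nat) (r ts t : R) (x y : R) : C :=
  \sum_(n < N) (mconst rt N r ts n.+1)^-1 * Mfun rt N r n.+1 x t
                * (Mfun rt N r n.+1 y (ts - t))^*.

(* n-fold Lebesgue integral over R^n, as an iterated (real-valued) Lebesgue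
   integral; for integrable functions this is the integral against the
   n-dimensional Lebesgue measure (Fubini). *)
Fixpoint iint (n : nat) : (n.-tuple R -> R) -> R :=
  match n return (n.-tuple R -> R) -> R with
  | 0 => fun g => g [tuple]
  | n'.+1 => fun g =>
      Rintegral (@lebesgue_measure R) setT
        (fun y => iint n' (fun s : n'.-tuple R => g (cons_tuple y s)))
  end.

(* complex-valued version *)
Definition iintC (n : nat) (g : n.-tuple R -> C) : C :=
  iint n (fun x => reC (g x)) +i* iint n (fun x => imC (g x)).

End RS.

Arguments SN {R}. Arguments Dom {R}. Arguments pdens {R}. Arguments Kker {R}.
Arguments iint {R}. Arguments iintC {R}. Arguments Mfun {R}. Arguments mconst {R}.
Arguments qdens {R}. Arguments mprod {R}. Arguments ThetaSharp {R}.
Arguments Jr {R}. Arguments Ncal {R}. Arguments xi {R}. Arguments taut {R}.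
Arguments upper_ok {R}.

(* Main.v *)
Require Import Defs.
From HB Require Import structures.
From mathcomp Require Import all_boot all_order all_algebra.
From mathcomp Require Import all_classical all_reals all_analysis.
From mathcomp Require Import complex measurable_realfun fingroup perm.
From mathcomp Require Import zify ring lra.
Import Order.TTheory GRing.Theory Num.Theory.
Import numFieldNormedType.Exports.
Local Open Scope ring_scope.
Local Open Scope complex_scope.
Local Open Scope classical_set_scope.

(* The functions [M_j(., t)] and the conjugates of [M_k(., ts - t)] are
   biorthogonal on the one-particle space: expanding the theta functions, each
   [M_j] is a series of exponentials (type A), sines (B, C) or cosines (D) whose
   frequencies are distinct for distinct [(n, j)], and the doubled constants
   [m_j] come from the pairs [n, n'] with opposite frequencies. Hence the density
   is [\det K(x_a, x_b)] restricted to increasing configurations, with [K] a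
   projection kernel.  This determinant is symmetric and vanishes on ties, so
   summing over all orderings gives the [N]-point correlation function.  The
   others follow by integrating out one variable at a time: with [A] the matrix
   of [K] on the remaining points, expanding the bordered determinant gives
   [K(y,y) \det A - \sum_(j,k) K(y,x_k) (\adj A)_kj K(x_j,y)], whose integral is
   [N \det A - \tr(\adj A * A) = (N - n) \det A]. *)

(** * Iterated integrals of bounded measurable functions *)

(** In the integral of [M_j(., t)] against the conjugate of [M_j(., ts - t)] the coefficients
    multiply, so the times add up to [ts]. For the doubled indices, reflection to the opposite
    frequency leaves these coefficients unchanged, because their exponent is a multiple of a squared
    frequency up to a constant. The coefficients form a summable majorant independent of the point,
    so every series converges uniformly and may be integrated term by term on a domain of finite
    length. Two obstacles shape the rest. The law is known only on measurable sets, through a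
    complex expression, and must first be extended to bounded test functions. And the matrix [A] may
    be singular, so the bordered determinant has to be expanded with the adjugate instead of the
    inverse. *)

Section BoundedMeasurable.
Context {R : realType}.

(** The class used throughout: it is stable under algebra, measurable substitution and integrating
    out a variable, and its members are integrable on sets of finite measure. Integrability and
    Fubini conditions thus reduce to membership in it. *)
Definition bm {d} {T : measurableType d} (g : T -> R) : Prop :=
  measurable_fun setT g /\ exists B : R, forall x, `|g x| <= B.

Context {d} {T : measurableType d}.
Implicit Types g h : T -> R.

Lemma bm_cst c : bm (fun _ : T => c).
Proof. by split; [exact: measurable_cst|exists `|c|]. Qed.

Lemma bmD g h : bm g -> bm h -> bm (fun x => g x + h x).
Proof.
move=> [mg [B gB]] [mh [C hC]]; split; first exact: measurable_funD.
by exists (B + C) => x; rewrite (le_trans (ler_normD _ _)) ?lerD.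
Qed.

Lemma bmM g h : bm g -> bm h -> bm (fun x => g x * h x).
Proof.
move=> [mg [B gB]] [mh [C hC]]; split; first exact: measurable_funM.
by exists (B * C) => x; rewrite normrM ler_pM.
Qed.

Lemma bmN g : bm g -> bm (fun x => - g x).
Proof.
by move=> [mg [B gB]]; split; [exact: measurableT_comp|exists B => x; rewrite normrN].
Qed.

Lemma bm_sum (I : Type) (r : seq I) (Q : pred I) (g : I -> T -> R) :
  (forall i, bm (g i)) -> bm (fun x => \sum_(i <- r | Q i) g i x).
Proof.
move=> bg; elim: r => [|i r IH].
  by under eq_fun do rewrite big_nil; exact: bm_cst.
by under eq_fun do rewrite big_cons; case: (Q i) => //; exact: bmD.
Qed.

Lemma bm_indic (A : set T) : measurable A -> bm (\1_A : T -> R).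
Proof.
move=> mA; split; first exact: measurable_indic.
by exists 1 => x; rewrite indicE; case: (_ \in _); rewrite ?normr1 ?normr0.
Qed.

Lemma bm_comp {d'} {T' : measurableType d'} (u : T' -> T) g :
  measurable_fun setT u -> bm g -> bm (fun x => g (u x)).
Proof.
move=> mu [mg [B gB]]; split; first exact: (measurableT_comp mg mu).
by exists B.
Qed.

Lemma bm_norm g : bm g -> bm (fun x => `|g x|).
Proof.
case=> mg [B gB]; split; first exact: measurableT_comp.
by exists B => x; rewrite normr_id.
Qed.

Variables (mu : {measure set T -> \bar R}) (A : set T).
Hypotheses (mA : measurable A) (fA : (mu A < +oo)%E).

Lemma bm_integrable g : bm g -> mu.-integrable A (EFin \o g).
Proof.
move=> [mg [B gB]]; apply: measurable_bounded_integrable => //.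
  exact: measurable_funTS.
exists B; split; first exact: num_real.
by move=> C BC x _; exact: le_trans (gB x) (ltW BC).
Qed.

Lemma Rintegral_bound B g : bm g -> (forall x, `|g x| <= B) ->
  `|Rintegral mu A g| <= B * fine (mu A).
Proof.
move=> bg gB; rewrite -Rintegral_cst//.
apply: le_trans (le_normr_Rintegral _ _) _ => //; first exact: bm_integrable.
apply: le_Rintegral => //; last first.
- by apply: bm_integrable; exact: bm_cst.
- by apply: bm_integrable; exact: bm_norm.
Qed.

End BoundedMeasurable.

Section IterInt.
Context {R : realType}.
Variables (D : set R) (mD : measurable D) (fD : (lebesgue_measure D < +oo)%E).
Local Notation mu := (@lebesgue_measure R).

Definition RI (g : R -> R) : R := Rintegral mu D g.

Lemma RID g h : bm g -> bm h -> RI (fun x => g x + h x) = RI g + RI h.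
Proof. by move=> bg bh; apply: RintegralD => //; exact: bm_integrable. Qed.

Lemma RIZ a g : bm g -> RI (fun x => a * g x) = a * RI g.
Proof. by move=> bg; apply: RintegralZl => //; exact: bm_integrable. Qed.

Lemma RI_cst a : RI (fun=> a) = a * fine (mu D).
Proof. exact: Rintegral_cst. Qed.

Lemma RI_bound B g : bm g -> (forall x, `|g x| <= B) ->
  `|RI g| <= B * fine (mu D).
Proof.
by move=> bg gB; exact: Rintegral_bound.
Qed.

Lemma RI_mkcond g : RI g = Rintegral mu setT (fun y => \1_D y * g y).
Proof.
rewrite /RI Rintegral_mkcond; apply: eq_Rintegral => x _.
by rewrite patchE indicE; case: ifP => _; rewrite ?mul1r ?mul0r.
Qed.

Lemma integral_indic_RI g : bm g ->
  (\int[mu]_y (\1_D y * g y)%:E = (RI g)%:E)%E.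
Proof.
move=> bg; rewrite /RI /Rintegral fineK; last first.
  by apply: integrable_fin_num => //; exact: bm_integrable.
rewrite integral_mkcond; apply: eq_integral => x _.
by rewrite patchE indicE; case: ifP => _; rewrite ?mul1r ?mul0r.
Qed.

(** Measurability in the parameter is Tonelli's theorem for the positive and negative parts
    separately, after the restriction to [D] has been moved into the integrand. *)
Lemma bm_RI {d} {T : measurableType d} (g : T * R -> R) :
  bm g -> bm (fun t => RI (fun y => g (t, y))).
Proof.
move=> bg; have [mg [B gB]] := bg; split; last first.
  exists (B * fine (mu D)) => t; apply: RI_bound => //.
  by apply: (bm_comp (fun y => (t, y))) => //; exact: measurable_pair1.
pose h (z : T * R) : \bar R := (\1_D z.2 * g z)%:E.
have mh : measurable_fun setT h.
  apply/measurable_EFinP; apply: measurable_funM => //.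
  exact: (bm_comp (@snd T R) (\1_D) measurable_snd (bm_indic D mD)).1.
rewrite (_ : (fun t => _) = fun t =>
   fine ((\int[mu]_y h^\+ (t, y)) - (\int[mu]_y h^\- (t, y)))%E); last first.
  apply/funext => t; rewrite RI_mkcond /Rintegral [in LHS]integralE.
  by congr (fine (_ - _)%E); apply: eq_integral => y _; rewrite ?funeposE ?funenegE.
apply: measurableT_comp; first exact: fine_measurable.
apply: emeasurable_funB.
  have := @measurable_fun_fubini_tonelli_F _ _ T _ R mu h^\+%E.
  by apply => //; exact: measurable_funepos.
have := @measurable_fun_fubini_tonelli_F _ _ T _ R mu h^\-%E.
by apply => //; exact: measurable_funeneg.
Qed.

Lemma RI_swap (g : R * R -> R) : bm g ->
  RI (fun x => RI (fun y => g (x, y))) = RI (fun y => RI (fun x => g (x, y))).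
Proof.
have b1 (x : R) (k : R * R -> R) : bm k -> bm (fun y => k (x, y)).
  by apply: bm_comp; exact: measurable_pair1.
have b2 (y : R) (k : R * R -> R) : bm k -> bm (fun x => k (x, y)).
  by apply: bm_comp; exact: pair2_measurable.
pose h (k : R * R -> R) (z : R * R) : R := \1_D z.1 * (\1_D z.2 * k z).
have bh k : bm k -> bm (h k).
  move=> bk; apply: bmM; last apply: bmM => //.
    exact: (bm_comp (@fst R R) (\1_D) measurable_fst (bm_indic D mD)).
  exact: (bm_comp (@snd R R) (\1_D) measurable_snd (bm_indic D mD)).
(* Stated for a general [k] because it serves twice: for [g], to rewrite the iterated integral, and
   for its absolute value, to verify Fubini's hypothesis. *)
have E k : bm k -> (\int[mu]_x \int[mu]_y (h k (x, y))%:E =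
    (RI (fun x => RI (fun y => k (x, y))))%:E)%E.
  move=> bk; rewrite -integral_indic_RI; last exact: bm_RI.
  apply: eq_integral => x _; rewrite EFinM -integral_indic_RI; last exact: b1.
  have [xD|xD] := boolP (x \in D); last first.
    rewrite /h /= indicE (negbTE xD) mul0e integral0_eq// => y _.
    by rewrite mul0r.
  by rewrite /h /= indicE xD mul1e; apply: eq_integral => y _; rewrite mul1r.
move=> bg; apply: EFin_inj; rewrite -E// (@Fubini _ _ _ _ _ mu mu (EFin \o h g)).
  rewrite -integral_indic_RI; last first.
    apply: (@bm_RI _ _ (fun z => g (z.2, z.1))).
    by apply: bm_comp bg; apply/measurable_fun_pair.
  apply: eq_integral => y _; rewrite EFinM -integral_indic_RI; last exact: b2.
  have [xD|xD] := boolP (y \in D); last first.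
    rewrite /h /= indicE (negbTE xD) mul0e integral0_eq// => x _.
    by rewrite mul0r mulr0.
  by rewrite /h /= indicE xD mul1e; apply: eq_integral => x _; rewrite mul1r.
(* Integrability on the product is finiteness of the iterated integral of the absolute value, which
   [E] identifies with a real number. *)
apply/integrable12ltyP; first by apply/measurable_EFinP; case: (bh g bg).
rewrite [ltLHS](_ : _ = (\int[mu]_x \int[mu]_y
    (h (fun z => `|g z|) (x, y))%:E)%E); first by rewrite E ?ltry//; exact: bm_norm.
apply: eq_integral => x _; apply: eq_integral => y _ /=.
by rewrite /h /= !normrM !(@ger0_norm _ (\1_D _)).
Qed.

(** Counterpart of [iint] with every variable confined to [D]; since [D] has finite measure, bounded
    functions stay bounded and integrable at each stage. *)
Fixpoint dint (n : nat) : (n.-tuple R -> R) -> R :=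
  match n return (n.-tuple R -> R) -> R with
  | 0 => fun g => g [tuple]
  | n'.+1 => fun g => RI (fun y => dint n' (fun s => g (cons_tuple y s)))
  end.

Definition Dpow (n : nat) : set (n.-tuple R) :=
  [set x | forall a : 'I_n, D (tnth x a)].

Lemma Dpow_cons n y (s : n.-tuple R) :
  Dpow n.+1 (cons_tuple y s) <-> D y /\ Dpow n s.
Proof.
split=> [h|[Dy Ds]].
  by split=> [|a]; [have := h ord0|have := h (lift ord0 a)]; rewrite ?tnth0 ?tnthS.
by move=> a; case: (unliftP ord0 a) => [j ->|->]; rewrite ?tnth0 ?tnthS.
Qed.

Lemma iint0 n : iint n (fun _ : n.-tuple R => 0 : R) = 0.
Proof.
elim: n => //= n IH; rewrite [X in Rintegral _ _ X](_ : _ = fun=> 0).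
  by rewrite Rintegral_cst// mul0r.
by apply/funext => y; rewrite IH.
Qed.

Lemma iint_dint n (g : n.-tuple R -> R) :
  iint n (fun x => \1_(Dpow n) x * g x) = dint n g.
Proof.
elim: n g => [|n IH] g /=.
  by rewrite indicE mem_set ?mul1r// => -[].
rewrite RI_mkcond; apply: eq_Rintegral => y _.
have [Dy|Dy] := pselect (D y).
  rewrite indicE mem_set// mul1r -IH; congr iint; apply/funext => s.
  rewrite !indicE; congr (_%:R * _); congr (nat_of_bool _).
  apply/idP/idP => /set_mem h; apply/mem_set; last exact/Dpow_cons.
  by have [] := (Dpow_cons _ _ _).1 h.
rewrite [X in _ = X * _]indicE memNset// mul0r -[RHS](iint0 n).
congr iint; apply/funext => s.
by rewrite indicE memNset ?mul0r// => /Dpow_cons[].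
Qed.

Lemma measurable_cons_tuple n {d} {T : measurableType d} (u : T -> R)
  (v : T -> n.-tuple R) : measurable_fun setT u -> measurable_fun setT v ->
  measurable_fun setT (fun t => cons_tuple (u t) (v t)).
Proof. exact: measurable_cons. Qed.

Lemma bm_cons n (g : n.+1.-tuple R -> R) y :
  bm g -> bm (fun s => g (cons_tuple y s)).
Proof.
apply: (bm_comp (fun s => cons_tuple y s)).
by apply: measurable_cons_tuple => //; exact: measurable_id.
Qed.

(** The parameter space is arbitrary because the induction absorbs the outermost integration
    variable into it, passing from [T] to [T * R]. *)
Lemma bm_dint n {d} {T : measurableType d} (g : T * n.-tuple R -> R) :
  bm g -> bm (fun t => dint n (fun s => g (t, s))).
Proof.
elim: n d T g => [|n IH] d T g bg /=.
  by apply: bm_comp bg; exact: pair2_measurable.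
apply: (bm_RI (fun z => dint n (fun s => g (z.1, cons_tuple z.2 s)))).
apply: (IH _ _ (fun w => g (w.1.1, cons_tuple w.1.2 w.2))).
apply: bm_comp bg; apply/measurable_fun_pair.
  exact: measurableT_comp measurable_fst measurable_fst.
apply: measurable_cons_tuple => //.
exact: measurableT_comp measurable_snd measurable_fst.
Qed.

Lemma bm_dint_cons n (g : n.+1.-tuple R -> R) : bm g ->
  bm (fun y => dint n (fun s => g (cons_tuple y s))).
Proof.
move=> bg; apply: (bm_dint n (fun w => g (cons_tuple w.1 w.2))).
by apply: bm_comp bg; exact: measurable_cons_tuple.
Qed.

Lemma dintD n (g h : n.-tuple R -> R) : bm g -> bm h ->
  dint n (fun x => g x + h x) = dint n g + dint n h.
Proof.
elim: n g h => //= n IH g h bg bh.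
rewrite -RID; [|exact: bm_dint_cons..].
by congr RI; apply/funext => y; rewrite IH//; exact: bm_cons.
Qed.

Lemma dintZ n a (g : n.-tuple R -> R) : bm g ->
  dint n (fun x => a * g x) = a * dint n g.
Proof.
elim: n g => //= n IH g bg; rewrite -RIZ; last exact: bm_dint_cons.
by congr RI; apply/funext => y; rewrite IH//; exact: bm_cons.
Qed.

Lemma dint_bound n B (g : n.-tuple R -> R) : bm g ->
  (forall x, `|g x| <= B) -> `|dint n g| <= B * fine (mu D) ^+ n.
Proof.
elim: n g => [|n IH] g bg gB /=; first by rewrite mulr1.
rewrite exprSr mulrA; apply: RI_bound; first exact: bm_dint_cons.
by move=> y; apply: IH => //; exact: bm_cons.
Qed.

(** [dint] integrates the first coordinate outermost, whereas eliminating a point requires it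
    innermost; this moves it through the others. *)
Lemma dint_RI n (g : R * n.-tuple R -> R) : bm g ->
  dint n (fun s => RI (fun y => g (y, s))) =
  RI (fun y => dint n (fun s => g (y, s))).
Proof.
elim: n g => //= n IH g bg.
rewrite (_ : (fun z => _) =
  fun z => RI (fun y => dint n (fun s => g (y, cons_tuple z s)))).
  rewrite (RI_swap (fun w => dint n (fun s => g (w.2, cons_tuple w.1 s))))//.
  apply: (bm_dint n (fun w => g (w.1.2, cons_tuple w.1.1 w.2))).
  apply: bm_comp bg; apply/measurable_fun_pair.
    exact: measurableT_comp measurable_snd measurable_fst.
  apply: measurable_cons_tuple => //.
  exact: measurableT_comp measurable_fst measurable_fst.
apply/funext => z; apply: (IH (fun w => g (w.1, cons_tuple z w.2))).
by apply: bm_comp bg; apply/measurable_fun_pair => //; exact: measurable_cons_tuple.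
Qed.

Definition permt {n} (s : 'S_n) (x : n.-tuple R) : n.-tuple R :=
  [tuple tnth x (s i) | i < n].

Lemma permtM n (s u : 'S_n) x : permt s (permt u x) = permt (s * u)%g x.
Proof. by apply: eq_from_tnth => i; rewrite !tnth_mktuple permM. Qed.

Lemma measurable_permt n (s : 'S_n) : measurable_fun setT (@permt n s).
Proof.
apply/measurable_fun_tnthP => i.
rewrite (_ : _ \o _ = fun x => tnth x (s i)); first exact: measurable_tnth.
by apply/funext => x /=; rewrite tnth_mktuple.
Qed.

(** Either the swap avoids the first coordinate, and the induction hypothesis applies under the
    outer integral, or it exchanges the first two coordinates, which is [RI_swap]. *)
Lemma dint_adjacent n (i j : 'I_n) (g : n.-tuple R -> R) : j = i.+1 :> nat ->
  bm g -> dint n (fun x => g (permt (tperm i j) x)) = dint n g.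
Proof.
elim: n i j g => [[]//|n IH] i j g.
case: (unliftP ord0 j) => [j' ->|->//] /=.
case: (unliftP ord0 i) => [i' ->|->] /=.
  rewrite /bump /= !add1n => -[ij] bg; congr RI; apply/funext => y.
  rewrite -(IH i' j' (fun s => g (cons_tuple y s)))//; last exact: bm_cons.
  congr dint; apply/funext => s; congr g; apply: eq_from_tnth => a.
  rewrite tnth_mktuple; case: (unliftP ord0 a) => [a' ->|->].
    rewrite tnthS tnth_mktuple; case: tpermP => [/lift_inj->|/lift_inj->|].
    - by rewrite tpermL tnthS.
    - by rewrite tpermR tnthS.
    - by move=> /eqP + /eqP; rewrite !(inj_eq lift_inj) !(eq_sym a') => ai aj;
        rewrite tpermD// tnthS.
  by rewrite tpermD// !tnth0.
rewrite /bump /= add1n => -[j'0] bg {i j}.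
case: n => [|n] in j' j'0 g bg IH *; first by case: j' {j'0}.
have {j' j'0}-> : j' = ord0 by exact: val_inj.
rewrite /= (RI_swap (fun w => dint n (fun s =>
  g (cons_tuple w.1 (cons_tuple w.2 s))))); last first.
  apply: (bm_dint n (fun w => g (cons_tuple w.1.1 (cons_tuple w.1.2 w.2)))).
  apply: bm_comp bg; apply: measurable_cons_tuple.
    exact: measurableT_comp measurable_fst measurable_fst.
  apply: measurable_cons_tuple => //.
  exact: measurableT_comp measurable_snd measurable_fst.
congr RI; apply/funext => y; congr RI; apply/funext => z; congr dint.
apply/funext => s; congr g; apply: eq_from_tnth => a.
rewrite tnth_mktuple; case: (unliftP ord0 a) => [a' ->|->].
  case: (unliftP ord0 a') => [a'' ->|->].
    by rewrite tpermD// !tnthS.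
  by rewrite tpermR tnthS !tnth0.
by rewrite tpermL tnthS !tnth0.
Qed.

(** The permutations that preserve the integral are closed under products, so it suffices to treat
    transpositions, by induction on the gap between the two indices. *)
Lemma dint_permt n (s : 'S_n) (g : n.-tuple R -> R) : bm g ->
  dint n (fun x => g (permt s x)) = dint n g.
Proof.
pose inv (s : 'S_n) := forall g : n.-tuple R -> R, bm g ->
  dint n (fun x => g (permt s x)) = dint n g.
have invM s1 s2 : inv s1 -> inv s2 -> inv (s1 * s2)%g.
  move=> i1 i2 h bh; rewrite -(i1 h)// -(i2 (fun x => h (permt s1 x))).
    by congr dint; apply/funext => x; rewrite permtM.
  exact: bm_comp (measurable_permt _ _) bh.
have invT (k : nat) (i j : 'I_n) : j = (i + k.+1)%N :> nat -> inv (tperm i j).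
  elim: k j => [|k IH] j ij.
    by move=> h bh; apply: dint_adjacent => //; rewrite ij addn1.
  have ln : (i + k.+1 < n)%N by rewrite (leq_trans _ (ltn_ord j))// ij !addnS.
  pose l := Ordinal ln.
  have lj : inv (tperm l j).
    by move=> h bh; apply: dint_adjacent => //=; rewrite ij addnS.
  (* Conjugating [tperm i l], whose gap is one less, by the adjacent transposition [tperm l j] gives
     [tperm i j]. *)
  have -> : tperm i j = (tperm l j * (tperm i l * tperm l j))%g.
    have := tpermJ i l (tperm l j); rewrite /conjg tpermV tpermL tpermD => [<-//||].
      by rewrite -val_eqE /= -[X in _ != X]addn0 eqn_add2l.
    by rewrite -val_eqE /= ij -[X in _ != X]addn0 eqn_add2l.
  by apply: (invM _ _ lj); apply: invM => //; exact: IH.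
have invT' (i j : 'I_n) : inv (tperm i j).
  have [ij|ji|/val_inj->] := ltngtP i j.
  - by apply: (invT (j - i).-1); rewrite prednK ?subn_gt0// subnKC// ltnW.
  - by rewrite tpermC; apply: (invT (i - j).-1); rewrite prednK ?subn_gt0// subnKC// ltnW.
  - rewrite tperm1 => h bh; congr dint; apply/funext => x; congr h.
    by apply: eq_from_tnth => a; rewrite tnth_mktuple perm1.
have [ts -> _] := prod_tpermP s; elim: ts g => [|t ts IH] g bg.
  rewrite big_nil; congr dint; apply/funext => x; congr g.
  by apply: eq_from_tnth => a; rewrite tnth_mktuple perm1.
by rewrite big_cons; apply: (invM _ _ (invT' _ _) IH).
Qed.
End IterInt.

(** * Complex-valued bounded measurable functions and their iterated integrals *)

Section BoundedMeasurableC.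
Context {R : realType}.
Local Notation C := R[i].

Lemma reCD (a b : C) : reC (a + b) = reC a + reC b.
Proof. by case: a b => [? ?] []. Qed.
Lemma imCD (a b : C) : imC (a + b) = imC a + imC b.
Proof. by case: a b => [? ?] []. Qed.
Lemma reCM (a b : C) : reC (a * b) = reC a * reC b - imC a * imC b.
Proof. by case: a b => [? ?] []. Qed.
Lemma imCM (a b : C) : imC (a * b) = reC a * imC b + imC a * reC b.
Proof. by case: a b => [? ?] []. Qed.
Lemma eq_re_im (a b : C) : reC a = reC b -> imC a = imC b -> a = b.
Proof. by case: a b => [? ?] [? ?] /= -> ->. Qed.

Definition bmC {d} {T : measurableType d} (g : T -> C) : Prop :=
  bm (fun x => reC (g x)) /\ bm (fun x => imC (g x)).

Section Closure.
Context {d} {T : measurableType d}.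
Implicit Types g h : T -> C.

Lemma bmC_cst c : bmC (fun _ : T => c).
Proof. by split; exact: bm_cst. Qed.

Lemma bmC_real (f : T -> R) : bm f -> bmC (fun x => (f x)%:C).
Proof. by move=> bf; split => //; exact: bm_cst. Qed.

Lemma bmCD g h : bmC g -> bmC h -> bmC (fun x => g x + h x).
Proof.
move=> [g1 g2] [h1 h2]; split.
  by under eq_fun do rewrite reCD; exact: bmD.
by under eq_fun do rewrite imCD; exact: bmD.
Qed.

Lemma bmCM g h : bmC g -> bmC h -> bmC (fun x => g x * h x).
Proof.
move=> [g1 g2] [h1 h2]; split.
  by under eq_fun do rewrite reCM; apply: bmD; [|apply: bmN]; exact: bmM.
by under eq_fun do rewrite imCM; apply: bmD; exact: bmM.
Qed.

Lemma bmC_conj g : bmC g -> bmC (fun x => (conjc (g x))).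
Proof.
move=> [g1 g2]; split.
  by rewrite (_ : (fun x => _) = fun x => reC (g x))//; apply/funext => x; case: (g x).
by rewrite (_ : (fun x => _) = fun x => - imC (g x));
  [exact: bmN|apply/funext => x; case: (g x)].
Qed.

Lemma bmC_sum (I : Type) (r : seq I) (P : pred I) (g : I -> T -> C) :
  (forall i, bmC (g i)) -> bmC (fun x => \sum_(i <- r | P i) g i x).
Proof.
move=> bg; elim: r => [|i r IH].
  by under eq_fun do rewrite big_nil; exact: bmC_cst.
by under eq_fun do rewrite big_cons; case: (P i) => //; exact: bmCD.
Qed.

Lemma bmC_prod (I : Type) (r : seq I) (P : pred I) (g : I -> T -> C) :
  (forall i, bmC (g i)) -> bmC (fun x => \prod_(i <- r | P i) g i x).
Proof.
move=> bg; elim: r => [|i r IH].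
  by under eq_fun do rewrite big_nil; exact: bmC_cst.
by under eq_fun do rewrite big_cons; case: (P i) => //; exact: bmCM.
Qed.

Lemma bmC_det n (M : T -> 'M[C]_n) :
  (forall i j, bmC (fun x => M x i j)) -> bmC (fun x => \det (M x)).
Proof.
move=> bM; apply: bmC_sum => s; apply: bmCM; first exact: bmC_cst.
by apply: bmC_prod => i.
Qed.

Lemma bmC_comp {d'} {T' : measurableType d'} (u : T' -> T) g :
  measurable_fun setT u -> bmC g -> bmC (fun x => g (u x)).
Proof. by move=> mu [g1 g2]; split; [exact: bm_comp g1|exact: bm_comp g2]. Qed.

End Closure.
End BoundedMeasurableC.

Section IterIntC.
Context {R : realType}.
Local Notation C := R[i].
Variables (D : set R) (mD : measurable D) (fD : (lebesgue_measure D < +oo)%E).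

Definition RIC (g : R -> C) : C :=
  RI D (fun y => reC (g y)) +i* RI D (fun y => imC (g y)).

Definition dintC n (g : n.-tuple R -> C) : C :=
  dint D n (fun x => reC (g x)) +i* dint D n (fun x => imC (g x)).

Lemma RICD g h : bmC g -> bmC h -> RIC (fun x => g x + h x) = RIC g + RIC h.
Proof.
move=> [g1 g2] [h1 h2]; apply: eq_re_im => /=; rewrite ?reCD ?imCD -RID//=;
  by congr RI; apply/funext => x; rewrite ?reCD ?imCD.
Qed.

Lemma RICZ a g : bmC g -> RIC (fun x => a * g x) = a * RIC g.
Proof.
move=> [g1 g2]; apply: eq_re_im => /=; rewrite ?reCM ?imCM /= -!RIZ//.
  rewrite -[X in _ = _ + X]mulN1r -RIZ//; last by apply: bmM => //; exact: bm_cst.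
  rewrite -RID//; [|by do ?apply: bmM => //; exact: bm_cst..].
  by congr RI; apply/funext => x; rewrite reCM mulN1r.
rewrite -RID//; [|by apply: bmM => //; exact: bm_cst..].
by congr RI; apply/funext => x; rewrite imCM.
Qed.

Lemma RIC_sum (I : Type) (r : seq I) (P : pred I) (g : I -> R -> C) :
  (forall i, bmC (g i)) ->
  RIC (fun x => \sum_(i <- r | P i) g i x) = \sum_(i <- r | P i) RIC (g i).
Proof.
move=> bg; elim: r => [|i r IH].
  rewrite big_nil; under eq_fun do rewrite big_nil.
  by rewrite /RIC /= !RI_cst// !mul0r.
rewrite big_cons -IH; under eq_fun do rewrite big_cons.
by case: (P i) => //; rewrite RICD//; exact: bmC_sum.
Qed.

Lemma iintC_dintC n (g : n.-tuple R -> C) :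
  iintC n (fun x => (\1_(Dpow D n) x)%:C * g x) = dintC n g.
Proof.
apply: eq_re_im => /=; rewrite -iint_dint; congr iint; apply/funext => x.
  by rewrite reCM mul0r subr0.
by rewrite imCM mul0r addr0.
Qed.

Lemma dintCD n (g h : n.-tuple R -> C) : bmC g -> bmC h ->
  dintC n (fun x => g x + h x) = dintC n g + dintC n h.
Proof.
move=> [g1 g2] [h1 h2]; apply: eq_re_im => /=; rewrite ?reCD ?imCD -dintD//=;
  by congr dint; apply/funext => x; rewrite ?reCD ?imCD.
Qed.

Lemma dintCZ n a (g : n.-tuple R -> C) : bmC g ->
  dintC n (fun x => a * g x) = a * dintC n g.
Proof.
move=> [g1 g2]; apply: eq_re_im => /=; rewrite ?reCM ?imCM /= -!dintZ//.
  rewrite -[X in _ = _ + X]mulN1r -dintZ//; last by apply: bmM => //; exact: bm_cst.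
  rewrite -dintD//; [|by do ?apply: bmM => //; exact: bm_cst..].
  by congr dint; apply/funext => x; rewrite reCM mulN1r.
rewrite -dintD//; [|by apply: bmM => //; exact: bm_cst..].
by congr dint; apply/funext => x; rewrite imCM.
Qed.

Lemma dintC0 n : dintC n (fun=> 0) = 0.
Proof.
by have := dintCZ n 0 (fun=> 0) (bmC_cst 0); rewrite !mul0r.
Qed.

Lemma dintC_sum n (I : Type) (r : seq I) (P : pred I) (g : I -> n.-tuple R -> C) :
  (forall i, bmC (g i)) ->
  dintC n (fun x => \sum_(i <- r | P i) g i x) = \sum_(i <- r | P i) dintC n (g i).
Proof.
move=> bg; elim: r => [|i r IH].
  by rewrite big_nil -[RHS](dintC0 n); under eq_fun do rewrite big_nil.
rewrite big_cons -IH; under eq_fun do rewrite big_cons.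
by case: (P i) => //; rewrite dintCD//; exact: bmC_sum.
Qed.

Lemma dintC_cons n (g : n.+1.-tuple R -> C) : bmC g ->
  dintC n.+1 g = dintC n (fun s => RIC (fun y => g (cons_tuple y s))).
Proof.
move=> [g1 g2]; apply: eq_re_im => /=.
  rewrite (dint_RI D mD fD n (fun w => reC (g (cons_tuple w.1 w.2))))//.
  by apply: bm_comp g1; exact: measurable_cons_tuple.
rewrite (dint_RI D mD fD n (fun w => imC (g (cons_tuple w.1 w.2))))//.
by apply: bm_comp g2; exact: measurable_cons_tuple.
Qed.

Lemma dintC_permt n (s : 'S_n) (g : n.-tuple R -> C) : bmC g ->
  dintC n (fun x => g (permt s x)) = dintC n g.
Proof.
move=> [g1 g2]; apply: eq_re_im => /=.
  exact: (dint_permt D mD fD n s _ g1).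
exact: (dint_permt D mD fD n s _ g2).
Qed.

End IterIntC.

(** * Projection kernels *)

Section BorderedDeterminant.

(** Right multiplication by a block triangular matrix built from [\adj M] clears the lower left
    block [b]. The common factor [\det M ^+ n] arises from [\det M * \det (\adj M)] and cannot be
    cancelled when [M] is singular. *)
Lemma det_border_mul (A : comNzRingType) n (d : 'M[A]_1) (c : 'rV[A]_n)
    (b : 'cV[A]_n) (M : 'M[A]_n) :
  \det (block_mx d c b M : 'M[A]_(1 + n)) * \det M ^+ n =
  (d 0 0 * \det M - (c *m \adj M *m b) 0 0) * \det M ^+ n.
Proof.
have E : (block_mx d c b M : 'M[A]_(1 + n)) *m
   block_mx (\det M)%:M 0 (- (\adj M *m b)) (\adj M) =
   block_mx (d *m (\det M)%:M - c *m \adj M *m b) (c *m \adj M) 0 (\det M)%:M.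
  rewrite mulmx_block !mulmxN !mulmx0 !add0r mulmxA; congr block_mx.
  - by rewrite mulmxA mul_mx_adj mul_scalar_mx mul_mx_scalar subrr.
  - by rewrite mul_mx_adj.
have := congr1 determinant E.
rewrite det_mulmx det_lblock det_ublock !det_scalar expr1 -det_mulmx mul_mx_adj.
rewrite det_scalar mul_mx_scalar det_mx11 => ->; congr (_ * _).
by rewrite mxE [(_ *: d) 0 0]mxE [fun_of_matrix (- _) 0 0]mxE mulrC.
Qed.

Lemma det_border (F : fieldType) n (d : 'M[F]_1) (c : 'rV[F]_n)
    (b : 'cV[F]_n) (M : 'M[F]_n) :
  \det (block_mx d c b M : 'M[F]_(1 + n)) =
  d 0 0 * \det M - (c *m \adj M *m b) 0 0.
Proof.
pose ev : {rmorphism {poly F} -> F} := horner_eval (0 : F).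
pose p (m k : nat) (B : 'M[F]_(m, k)) := map_mx (@polyC F) B.
have evp m k (B : 'M[F]_(m, k)) : map_mx ev (p m k B) = B.
  by apply/matrixP => i j; rewrite !mxE /ev /= /horner_eval hornerC.
have evM : map_mx ev (char_poly_mx (- M)) = M.
  apply/matrixP => i j; rewrite !mxE /ev /= /horner_eval hornerD hornerMn hornerX.
  by rewrite mul0rn add0r hornerN hornerC opprK.
have := det_border_mul _ n (p _ _ d) (p _ _ c) (p _ _ b) (char_poly_mx (- M)).
have nz : \det (char_poly_mx (- M)) ^+ n != 0.
  by rewrite expf_neq0// monic_neq0// char_poly_monic.
move=> /(mulIf nz)/(congr1 ev).
rewrite rmorphB rmorphM /= -!det_map_mx map_block_mx !evp evM => ->.
congr (_ * _ - _); first by have /matrixP/(_ 0 0) := evp _ _ d; rewrite mxE.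
have /matrixP/(_ 0 0) : map_mx ev (p _ _ c *m \adj (char_poly_mx (- M)) *m p _ _ b) =
  c *m \adj M *m b by rewrite !map_mxM map_mx_adj !evp evM.
by rewrite mxE.
Qed.

End BorderedDeterminant.

Section Kernel.
Context {R : realType}.
Local Notation C := R[i].
Variables (D : set R) (mD : measurable D) (fD : (lebesgue_measure D < +oo)%E).
Variables (N : nat) (phi psi : 'I_N -> R -> C).
Hypotheses (bphi : forall i, bmC (phi i)) (bpsi : forall i, bmC (psi i)).
Hypothesis biorth : forall i j, RIC D (fun y => phi i y * psi j y) = (i == j)%:R.

Definition kern (x y : R) : C := \sum_i phi i x * psi i y.
Definition kern_mx n (x : n.-tuple R) : 'M[C]_n :=
  \matrix_(a, b) kern (tnth x a) (tnth x b).

Let bmC_kern {d} {T : measurableType d} (u v : T -> R) :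
  measurable_fun setT u -> measurable_fun setT v ->
  bmC (fun t => kern (u t) (v t)).
Proof.
by move=> mu mv; apply: bmC_sum => i; apply: bmCM;
  [exact: bmC_comp (bphi i)|exact: bmC_comp (bpsi i)].
Qed.

Lemma bmC_det_kern n : bmC (fun x : n.-tuple R => \det (kern_mx n x)).
Proof.
apply: bmC_det => i j; under eq_fun do rewrite mxE.
by apply: bmC_kern; exact: measurable_tnth.
Qed.

Lemma RIC_kern_trace : RIC D (fun y => kern y y) = N%:R.
Proof.
rewrite RIC_sum//; last by move=> i; exact: bmCM.
under eq_bigr do rewrite biorth eqxx.
by rewrite sumr_const card_ord.
Qed.

(** Reproducing property: biorthogonality reduces the double sum to its diagonal. *)
Lemma RIC_kern_kern x z : RIC D (fun y => kern x y * kern y z) = kern x z.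
Proof.
rewrite (_ : (fun y => _) = fun y => \sum_i \sum_j
    phi i x * psi j z * (phi j y * psi i y)).
  rewrite RIC_sum//; last first.
    move=> i; apply: bmC_sum => j; apply: bmCM; first exact: bmC_cst.
    exact: bmCM.
  apply: eq_bigr => i _; rewrite RIC_sum//; last first.
    by move=> j; apply: bmCM; [exact: bmC_cst|exact: bmCM].
  rewrite (bigD1 i)//= big1 => [|j ji]; rewrite RICZ ?biorth//; try exact: bmCM.
    by rewrite eqxx mulr1 addr0.
  by rewrite (negbTE ji) mulr0.
apply/funext => y; rewrite /kern mulr_suml; apply: eq_bigr => i _.
by rewrite mulr_sumr; apply: eq_bigr => j _; ring.
Qed.

Lemma kern_mx_cons n y (s : n.-tuple R) :
  kern_mx n.+1 (cons_tuple y s) = block_mx (kern y y)%:M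
    (\row_b kern y (tnth s b)) (\col_a kern (tnth s a) y) (kern_mx n s)
    :> 'M[C]_(1 + n).
Proof.
have l0 : ord0 = lshift n (ord0 : 'I_1) by exact: val_inj.
have lr (i : 'I_n) : lift ord0 i = rshift 1 i by exact: val_inj.
apply/matrixP => a b; rewrite [LHS]mxE.
case: (unliftP ord0 a) => [a' ->|->]; case: (unliftP ord0 b) => [b' ->|->];
  rewrite ?tnthS ?tnth0 ?lr ?l0 ?block_mxEul ?block_mxEur ?block_mxEdl ?block_mxEdr;
  by rewrite !mxE.
Qed.

Lemma RIC_det_kern n (s : n.-tuple R) :
  RIC D (fun y => \det (kern_mx n.+1 (cons_tuple y s))) =
  (N%:R - n%:R) * \det (kern_mx n s).
Proof.
set A := kern_mx n s.
pose S y := \sum_j \sum_k \adj A k j * (kern (tnth s j) y * kern y (tnth s k)).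
have bS j k : bmC (fun y => kern (tnth s j) y * kern y (tnth s k)).
  by apply: bmCM; apply: bmC_kern => //; exact: measurable_cst.
rewrite (_ : (fun y => _) = fun y => \det A * kern y y + (-1) * S y).
  rewrite RICD//; first last.
  - apply: bmCM; first exact: bmC_cst.
    by do 2!apply: bmC_sum => ?; apply: bmCM => //; exact: bmC_cst.
  - by apply: bmCM; [exact: bmC_cst|exact: bmC_kern].
  rewrite !RICZ//; last 2 first.
  - by do 2!apply: bmC_sum => ?; apply: bmCM => //; exact: bmC_cst.
  - exact: bmC_kern.
  rewrite RIC_kern_trace /S RIC_sum//; last first.
    by move=> i; apply: bmC_sum => ?; apply: bmCM => //; exact: bmC_cst.
  under eq_bigr => j _.
    rewrite RIC_sum//; last by move=> k; apply: bmCM => //; exact: bmC_cst.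
    under eq_bigr do rewrite RICZ// RIC_kern_kern.
    over.
  rewrite exchange_big /=.
  suff -> : \sum_k \sum_j \adj A k j * kern (tnth s j) (tnth s k) = n%:R * \det A.
    by rewrite mulN1r mulrBl mulrC.
  rewrite mulr_natl -mxtrace_scalar -mul_adj_mx; apply: eq_bigr => k _; rewrite mxE.
  by apply: eq_bigr => j _; congr (_ * _); rewrite mxE.
apply/funext => y; rewrite kern_mx_cons det_border mxE eqxx mulr1n mulrC mulN1r.
congr (_ - _); rewrite mxE; apply: eq_bigr => j _; rewrite mxE mulr_suml.
by apply: eq_bigr => k _; rewrite !mxE; ring.
Qed.

(** With exactly [N] points the kernel matrix is a product of two square matrices, the transposed
    values of [phi] and the values of [psi]. This links the kernel to the product form of the
    density. *)
Lemma det_kern_mxE (x : N.-tuple R) :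
  \det (kern_mx N x) = \det (\matrix_(j, k) psi j (tnth x k))
    * \det (\matrix_(l, m) phi l (tnth x m)).
Proof.
rewrite mulrC -(det_tr (\matrix_(l, m) phi l _)) -det_mulmx; congr determinant.
apply/matrixP => a b; rewrite !mxE; apply: eq_bigr => i _.
by rewrite !mxE.
Qed.

(** Rows and columns undergo the same permutation, so the two signs cancel. *)
Lemma det_kern_mx_permt n (s : 'S_n) x :
  \det (kern_mx n (permt s x)) = \det (kern_mx n x).
Proof.
rewrite (_ : kern_mx n (permt s x) = row_perm s (col_perm s (kern_mx n x))).
  rewrite row_permE col_permE !det_mulmx !det_perm mulrCA odd_permV.
  by rewrite -signr_addb addbb mulr1.
by apply/matrixP => a b; rewrite !mxE !tnth_mktuple.
Qed.

Lemma det_kern_mx_tie n (x : n.-tuple R) (a b : 'I_n) : a != b ->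
  tnth x a = tnth x b -> \det (kern_mx n x) = 0.
Proof.
by move=> ab xab; apply: (determinant_alternate ab) => c; rewrite !mxE xab.
Qed.

End Kernel.

(** * Determinantal structure from a symmetrized density *)

Section BoundedFunctional.
Context {R : realType} {d} {T : measurableType d}.
Variables (Lam : (T -> R) -> R) (c : R).
Hypotheses (LamD : forall g h, bm g -> bm h ->
              Lam (fun x => g x + h x) = Lam g + Lam h)
  (LamZ : forall a g, bm g -> Lam (fun x => a * g x) = a * Lam g)
  (Lam_bound : forall (B : R) g, bm g -> (forall x, `|g x| <= B) -> `|Lam g| <= B * c)
  (Lam_indic : forall A, measurable A -> Lam (\1_A) = 0).

Let Lam_sum m (a : 'I_m -> R) (A : 'I_m -> set T) :
  (forall i, measurable (A i)) ->
  bm (fun x => \sum_i a i * \1_(A i) x) /\ Lam (fun x => \sum_i a i * \1_(A i) x) = 0.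
Proof.
move=> mA; elim: m a A mA => [|m IH] a A mA.
  under eq_fun do rewrite big_ord0.
  split; first exact: bm_cst.
  by have := LamZ 0 (fun=> 0) (bm_cst 0); rewrite !mul0r.
have [b0 L0] := IH (fun i => a (lift ord0 i)) (fun i => A (lift ord0 i))
  (fun i => mA (lift ord0 i)).
have bA (i : 'I_m.+1) : bm (fun x => a i * \1_(A i) x).
  by apply: bmM; [exact: bm_cst|exact: bm_indic].
under eq_fun do rewrite big_ord_recl; split; first exact: bmD.
by rewrite LamD// L0 addr0 LamZ ?Lam_indic ?mulr0//; exact: bm_indic.
Qed.

(* The rounded functions [floor (k * g) / k] are simple and converge to [g]
   uniformly. *)
Lemma bounded_functional_eq0 g : bm g -> Lam g = 0.
Proof.
move=> bg; have [mg [B gB]] := bg.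
suff H k : (0 < k)%N -> `|Lam g| <= c / k%:R.
  apply/eqP; rewrite -normr_le0; apply/ler_addgt0Pr => e e0; rewrite add0r.
  pose k := (Num.trunc (c / e)).+1.
  apply: le_trans (H k isT) _; rewrite ler_pdivrMr// mulrC -ler_pdivrMr//.
  exact/ltW/truncnS_gt.
move=> k0.
have k0R : 0 < k%:R :> R by rewrite ltr0n.
(* Adding [L] makes [k * g + L] nonnegative, so truncation to a natural number is a floor; its
   values stay within [0 .. L + L]. *)
pose L := (Num.trunc (k%:R * B)).+1.
pose a (i : 'I_(L + L).+1) : R := (i%:R - L%:R) / k%:R.
pose A (i : 'I_(L + L).+1) : set T := [set x | a i <= g x < a i + k%:R^-1].
have mA i : measurable (A i).
  rewrite (_ : A i = setT `&` g @^-1` `[a i, a i + k%:R^-1[).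
    by apply: mg => //; exact: measurable_itv.
  by apply/seteqP; split => x; rewrite /A /= in_itv /=; tauto.
have [bs Ls] := Lam_sum _ a A mA.
have -> : Lam g = Lam (fun x => g x + (-1) * \sum_i a i * \1_(A i) x).
  rewrite LamD//; last by apply: bmM => //; exact: bm_cst.
  by rewrite LamZ// Ls mulr0 addr0.
rewrite mulrC; apply: Lam_bound => [|x].
  by apply: bmD => //; apply: bmM => //; exact: bm_cst.
have ge0 : 0 <= k%:R * g x + L%:R.
  have : `|k%:R * g x| <= k%:R * B by rewrite normrM gtr0_norm// ler_pM2l.
  have : k%:R * B < L%:R by exact: truncnS_gt.
  by rewrite ler_norml => /ltW h1 /andP[h2 _]; lra.
pose m := Num.trunc (k%:R * g x + L%:R).
have mL : (m < (L + L).+1)%N.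
  have h0 : k%:R * g x + L%:R <= (L + L)%:R.
    have h1 : `|k%:R * g x| <= k%:R * B by rewrite normrM gtr0_norm// ler_pM2l.
    have h2 : k%:R * B < L%:R by exact: truncnS_gt.
    move: h1; rewrite ler_norml natrD => /andP[_ h1]; lra.
  rewrite ltnS -(ler_nat R); apply: le_trans h0.
  by rewrite truncn_le.
have mle : m%:R <= k%:R * g x + L%:R by rewrite truncn_le.
have mgt : k%:R * g x + L%:R < m.+1%:R by exact: truncnS_gt.
have aE (i : 'I_(L + L).+1) : A i x <-> i = m :> nat.
  rewrite /A /= /a (_ : _ / _ + _ = (i%:R - L%:R + 1) / k%:R); last first.
    by rewrite [RHS]mulrDl mul1r.
  rewrite ler_pdivrMr// ltr_pdivlMr// [g x * _]mulrC.
  split=> [/andP[h1 h2]|->].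
    have h3 : i%:R < m.+1%:R :> R by lra.
    have h4 : m%:R < i.+1%:R :> R by rewrite -natr1; lra.
    by move: h3 h4; rewrite !ltr_nat !ltnS => h3 h4; apply/eqP; rewrite eqn_leq h3 h4.
  by move: mgt; rewrite -natr1 => mgt; apply/andP; split; lra.
rewrite (bigD1 (Ordinal mL))//= big1 => [|i im]; last first.
  rewrite indicE memNset ?mulr0// => /aE E; case/negP: im.
  by apply/eqP/val_inj.
have Am : A (Ordinal mL) x by apply/aE.
rewrite addr0 indicE mem_set// mulr1; move: Am => /= /andP[h1 h2].
by rewrite mulN1r ger0_norm ?subr_ge0//; lra.
Qed.

End BoundedFunctional.

(** * Increasing configurations and counting of index tuples *)

Section IncreasingTuples.
Context {R : realType}.

Definition incr (N : nat) : set (N.-tuple R) :=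
  [set x | forall i j : 'I_N, (i < j)%N -> tnth x i < tnth x j].

Lemma incrP N (x : N.-tuple R) : incr N x <-> sorted <%O x.
Proof.
rewrite (sorted_pairwise lt_trans); split=> [h|/(pairwiseP 0) h i j ij].
  apply/(pairwiseP 0) => i j; rewrite !inE size_tuple => iN jN ij.
  by have := h (Ordinal iN) (Ordinal jN) ij; rewrite !(tnth_nth 0).
by rewrite !(tnth_nth 0); apply: h => //; rewrite inE size_tuple.
Qed.

Lemma measurable_incr N : measurable (incr N).
Proof.
have mlt (i j : 'I_N) : measurable [set x : N.-tuple R | tnth x i < tnth x j].
  rewrite (_ : [set _ | _] =
    setT `&` (fun x : N.-tuple R => tnth x j - tnth x i) @^-1` `]0, +oo[).
    apply: (measurable_funB (measurable_tnth j) (measurable_tnth i)) => //.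
  by rewrite setTI; apply/seteqP; split => x /=; rewrite in_itv /= andbT subr_gt0.
rewrite (_ : incr N = \bigcap_(i in [set: 'I_N]) \bigcap_(j in [set j : 'I_N | (i < j)%N])
   [set x | tnth x i < tnth x j]).
  by do 2!(apply: fin_bigcap_measurable => [|? _]; first exact: finite_finset).
apply/seteqP; split => x /= h; first by move=> i _ j /= /h.
by move=> i j ij; exact: h.
Qed.

Lemma perm_permt N (s : 'S_N) (x : N.-tuple R) : perm_eq (permt s x) x.
Proof. by apply/tuple_permP; exists s. Qed.

(** Exactly one rearrangement of distinct coordinates is increasing: sorting provides one, and two
    sorted lists with the same elements coincide. *)
Lemma sum_incr_permt N (x : N.-tuple R) : injective (tnth x) ->
  \sum_(s : 'S_N) \1_(incr N) (permt s x) = 1 :> R.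
Proof.
move=> xI.
have /tuple_permP[s0 /val_inj s0E] : perm_eq (sort_tuple <=%O x) x.
  by rewrite perm_sort.
have inc0 : incr N (permt s0 x).
  apply/incrP; rewrite -[permt s0 x]s0E /= lt_sorted_uniq_le sort_le_sorted sort_uniq.
  by rewrite andbT; apply/tuple_uniqP.
rewrite (bigD1 s0)//= indicE mem_set// big1 ?addr0// => s ss0.
rewrite indicE memNset// => incs; case/negP: ss0; apply/eqP/permP => i.
have E : permt s x = permt s0 x.
  apply/val_inj; apply: (@lt_sorted_eq _ R); try exact/incrP.
  apply: perm_mem; rewrite (perm_trans (perm_permt _ _ _))// perm_sym.
  exact: perm_permt.
by apply: xI; have := congr1 (fun y => tnth y i) E; rewrite !tnth_mktuple.
Qed.

End IncreasingTuples.

Lemma sum_uniq_tuple_perm (V : nmodType) N (G : N.-tuple 'I_N -> V) :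
  \sum_(j : N.-tuple 'I_N | uniq j) G j =
  \sum_(s : 'S_N) G [tuple s i | i < N].
Proof.
pose tp (s : 'S_N) := [tuple s i | i < N].
(* The default [1%g] is a dummy: a repetition-free tuple of length [N] always comes from a
   permutation. *)
pose h (j : N.-tuple 'I_N) : 'S_N := odflt 1%g [pick s | tp s == j].
rewrite (reindex_onto tp h) => [|j uj].
  apply: eq_bigl => s; apply/andP; split.
    by rewrite map_inj_uniq ?enum_uniq//; exact: perm_inj.
  rewrite /h; case: pickP => [u /eqP E|/(_ s)]; last by rewrite eqxx.
  apply/eqP/permP => i.
  by have := congr1 (fun y => tnth y i) E; rewrite !tnth_mktuple.
rewrite /h; case: pickP => [u /eqP//|].
have jI : injective (tnth j) by apply/tuple_uniqP.
move=> /(_ (perm jI)) /eqP[]; apply: eq_from_tnth => i.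
by rewrite tnth_mktuple permE.
Qed.

(** A repetition-free [n]-tuple can be extended at the front by any of the [N - n] indices that it
    omits. *)
Lemma sum_uniq_tuple_cons (V : nmodType) N n (G : n.-tuple 'I_N -> V) :
  \sum_(j : n.+1.-tuple 'I_N | uniq j) G (behead_tuple j) =
  (\sum_(j : n.-tuple 'I_N | uniq j) G j) *+ (N - n).
Proof.
rewrite (reindex (fun p : n.-tuple 'I_N * 'I_N => cons_tuple p.2 p.1)) /=; last first.
  exists (fun j => (behead_tuple j, thead j)) => [[j i]|j] _ /=.
    by congr pair; apply: val_inj.
  by rewrite [RHS](tuple_eta j); apply: val_inj.
rewrite -sumrMnl.
transitivity (\sum_(p : n.-tuple 'I_N * 'I_N | uniq p.1 && (p.2 \notin p.1)) G p.1).
  apply: eq_big => [[j i]|[j i] _] /=; first by rewrite andbC.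
  by congr G; apply: val_inj.
rewrite -(pair_big_dep (fun j : n.-tuple 'I_N => uniq j)
  (fun j i => i \notin j) (fun j _ => G j)) /=.
apply: eq_bigr => j uj; rewrite sumr_const; congr (_ *+ _).
have NE : N = (n + #|[predC mem j]|)%N.
  by rewrite -{1}(card_ord N) -(cardC (mem j)) (card_uniqP uj) size_tuple.
by rewrite [in RHS]NE addKn; apply: eq_card => i; rewrite !inE.
Qed.

Section Determinantal.
Context {R : realType}.
Local Notation C := R[i].
Variables (D : set R) (mD : measurable D) (fD : (lebesgue_measure D < +oo)%E).
Variable N : nat.
Context {d : measure_display} {Omega : measurableType d}.
Variables (P : probability Omega R) (X : Omega -> N.-tuple R).
Hypothesis mX : measurable_fun setT X.

(** The difference of the two sides is a linear functional of [F], bounded in the uniform norm and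
    zero on indicators, so [bounded_functional_eq0] applies. *)
Lemma expectation_density (h : N.-tuple R -> C) : bmC h ->
  (forall A : set (N.-tuple R), measurable A ->
    (fine (P (X @^-1` A)))%:C = dintC D N (fun x => (\1_A x)%:C * h x)) ->
  forall F : N.-tuple R -> R, bm F ->
  (Rintegral P setT (fun w => F (X w)))%:C = dintC D N (fun x => (F x)%:C * h x).
Proof.
move=> [h1 h2] law.
(* The factor [e] covers both components: [e = 1] for the real part of [h], and [e = 0] for the
   imaginary part, which integrates to zero over every set because probabilities are real. *)
have key (e : R) (w : N.-tuple R -> R) : bm w ->
    (forall A : set (N.-tuple R), measurable A ->
      e * fine (P (X @^-1` A)) = dint D N (fun x => \1_A x * w x)) ->
    forall F : N.-tuple R -> R, bm F ->
    e * Rintegral P setT (fun w => F (X w)) = dint D N (fun x => F x * w x).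
  move=> bw lawe F bF; apply/eqP; rewrite -subr_eq0; apply/eqP.
  have bX (g : N.-tuple R -> R) : bm g -> bm (fun w => g (X w)) by exact: bm_comp.
  have fP : (P setT < +oo)%E by rewrite probability_setT ltry.
  have iX g : bm g -> P.-integrable setT (EFin \o (fun w => g (X w))).
    by move=> bg; apply: bm_integrable => //; exact: bX.
  have [_ [W wW]] := bw.
  pose Lam (g : N.-tuple R -> R) :=
    e * Rintegral P setT (fun w => g (X w)) - dint D N (fun x => g x * w x).
  apply: (bounded_functional_eq0 Lam (`|e| + W * fine (lebesgue_measure D) ^+ N)) bF.
  - move=> g k bg bk; rewrite /Lam RintegralD//; [|exact: iX..].
    rewrite (_ : (fun x => _ * w x) = fun x => g x * w x + k x * w x).
      by rewrite dintD//; [lra|exact: bmM..].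
    by apply/funext => x; rewrite mulrDl.
  - move=> a g bg; rewrite /Lam RintegralZl//; last exact: iX.
    rewrite (_ : (fun x => _ * w x) = fun x => a * (g x * w x)).
      by rewrite dintZ//; [lra|exact: bmM].
    by apply/funext => x; rewrite mulrA.
  - move=> B g bg gB; rewrite /Lam mulrDr (le_trans (ler_normB _ _))// lerD//.
      rewrite normrM mulrC ler_wpM2r//.
      rewrite -[leRHS]mulr1 -[X in _ * X](_ : fine (P setT) = 1); last first.
        by rewrite probability_setT.
      by apply: Rintegral_bound => //; exact: bX.
    rewrite mulrA; apply: dint_bound => //; first exact: bmM.
    by move=> x; rewrite normrM ler_pM.
  - move=> A mA; rewrite /Lam -lawe// /Rintegral.
    rewrite (_ : (\int[P]_w (\1_A (X w))%:E)%E = P (X @^-1` A)) ?subrr//.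
    rewrite (_ : (fun w => _) = EFin \o \1_(X @^-1` A)).
      by rewrite integral_indic ?setIT// -[X in measurable X]setTI; exact: mX.
    by apply/funext => o /=; rewrite !indicE.
move=> F bF; apply: eq_re_im => /=.
  rewrite -[LHS]mul1r (key 1 (fun x => reC (h x)))//.
    by congr dint; apply/funext => x; rewrite reCM /= mul0r subr0.
  move=> A mA; rewrite mul1r; have /(congr1 reC) /= -> := law A mA.
  by congr dint; apply/funext => x; rewrite reCM /= mul0r subr0.
rewrite -[LHS](mul0r (Rintegral P setT (fun w => F (X w)))).
rewrite (key 0 (fun x => imC (h x)))//.
  by congr dint; apply/funext => x; rewrite imCM /= mul0r addr0.
move=> A mA; rewrite mul0r; have /(congr1 imC) /= -> := law A mA.
by congr dint; apply/funext => x; rewrite imCM /= mul0r addr0.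
Qed.

Variables phi psi : 'I_N -> R -> C.
Hypotheses (bphi : forall i, bmC (phi i)) (bpsi : forall i, bmC (psi i)).
Hypothesis biorth : forall i j, RIC D (fun y => phi i y * psi j y) = (i == j)%:R.
Local Notation K := (kern_mx N phi psi).
Hypothesis lawX : forall A : set (N.-tuple R), measurable A ->
  (fine (P (X @^-1` A)))%:C =
  dintC D N (fun x => (\1_A x)%:C * ((\1_(incr N) x)%:C * \det (K N x))).

Definition correlation n (f : n.-tuple R -> R) : R :=
  Rintegral P setT (fun w => \sum_(j : n.-tuple 'I_N | uniq j)
                 f (map_tuple (fun i => tnth (X w) i) j)).

Let bK n : bmC (fun x => \det (K n x)).
Proof. exact: bmC_det_kern. Qed.

Let bi : bm (\1_(incr N) : N.-tuple R -> R).
Proof. by apply: bm_indic; exact: measurable_incr. Qed.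

(* Since [\det (K N x)] vanishes when two coordinates of [x] coincide, the sets
   where [x] is sorted by a given permutation may be treated as a partition. *)
Lemma correlation_full (f : N.-tuple R -> R) : bm f ->
  (correlation N f)%:C = dintC D N (fun x => (f x)%:C * \det (K N x)).
Proof.
move=> bf; rewrite /correlation.
have bp (s : 'S_N) (g : N.-tuple R -> R) : bm g -> bm (fun x => g (permt s x)).
  by apply: bm_comp; exact: measurable_permt.
rewrite (_ : (fun w => _) = fun w => \sum_(s : 'S_N) f (permt s (X w))); last first.
  apply/funext => w; rewrite sum_uniq_tuple_perm; apply: eq_bigr => s _; congr f.
  by apply: eq_from_tnth => i; rewrite tnth_map !tnth_mktuple.
have bs : bm (fun x => \sum_(s : 'S_N) f (permt s x)).
  by apply: bm_sum => s; exact: bp.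
rewrite (expectation_density _ _ lawX _ bs); last first.
  by apply: bmCM => //; exact: bmC_real.
(* [G s] at [permt s x] is the summand of [s] at [x]. Undoing the permutation in each integral
   transfers it from [f] to the ordering indicator, and those indicators sum to one at distinct
   coordinates. *)
pose G (s : 'S_N) (x : N.-tuple R) : C :=
  (f x)%:C * ((\1_(incr N) (permt s^-1%g x))%:C * \det (K N x)).
have bG s : bmC (G s).
  by do !apply: bmCM => //; apply: bmC_real => //; exact: bp.
transitivity (dintC D N (fun x => \sum_s G s (permt s x))).
  congr dintC; apply/funext => x; rewrite rmorph_sum mulr_suml.
  apply: eq_bigr => s _; rewrite /G permtM mulVg det_kern_mx_permt.
  congr (_ * (_%:C * _)); congr (\1_ _ _).
  by apply: eq_from_tnth => i; rewrite tnth_mktuple perm1.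
rewrite dintC_sum//; last first.
  by move=> s; apply: bmC_comp (bG s); exact: measurable_permt.
rewrite (eq_bigr (fun s => dintC D N (G s))); last by move=> s _; rewrite dintC_permt.
rewrite -dintC_sum//; congr dintC; apply/funext => x.
rewrite -mulr_sumr -mulr_suml; congr (_ * _).
have [xI|] := pselect (injective (tnth x)).
  rewrite -rmorph_sum (reindex_inj invg_inj) /=.
  by under eq_bigr do rewrite invgK; rewrite sum_incr_permt// mul1r.
move=> /existsNP[a /existsNP[b /not_implyP[xab /eqP ab]]].
by rewrite (det_kern_mx_tie _ _ _ _ _ _ _ ab xab) mulr0.
Qed.

(** Descending induction from [n = N]. Testing level [n.+1] with a function [f'] that ignores the
    first coordinate produces [N - n] on both sides, by counting extensions on the left and by
    [RIC_det_kern] on the right; it is nonzero for [n < N] and cancels. *)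
Lemma correlationE n (f : n.-tuple R -> R) : (n <= N)%N -> bm f ->
  (correlation n f)%:C = dintC D n (fun x => (f x)%:C * \det (K n x)).
Proof.
move=> nN; have [k kE] : exists k, N = (n + k)%N by exists (N - n)%N; rewrite subnKC.
elim: k n f nN kE => [|k IH] n f nN kE bf.
  by move: kE f bf; rewrite addn0 => <- f bf; exact: correlation_full.
have nN' : (n < N)%N by rewrite kE addnS ltnS leq_addr.
have nz : (N - n)%:R != 0 :> C by rewrite pnatr_eq0 -lt0n subn_gt0.
pose f' (x : n.+1.-tuple R) := f (behead_tuple x).
have bf' : bm f'.
  apply: (bm_comp (fun x : n.+1.-tuple R => behead_tuple x)) bf.
  exact: measurable_behead.
have kE' : N = (n.+1 + k)%N by rewrite addSnnS.
have := IH n.+1 f' nN' kE' bf'.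
have -> : correlation n.+1 f' = correlation n f *+ (N - n).
  rewrite /correlation -mulr_natl -RintegralZl//; last first.
    have fP : (P setT < +oo)%E by rewrite probability_setT ltry.
    apply: bm_integrable => //.
    apply: bm_sum => j; apply: bm_comp bf.
    apply/measurable_fun_tnthP => i.
    rewrite (_ : _ \o _ = (fun x => tnth x (tnth j i)) \o X).
      exact: measurableT_comp (measurable_tnth _) mX.
    by apply/funext => w /=; rewrite tnth_map.
  apply: eq_Rintegral => w _; rewrite mulr_natl -sum_uniq_tuple_cons.
  by apply: eq_bigr => j _; congr f; apply: val_inj; rewrite /= behead_map.
rewrite dintC_cons//; last by apply: bmCM => //; exact: bmC_real.
rewrite (_ : (fun s => RIC D _) =
   fun s => (N - n)%:R * ((f s)%:C * \det (K n s))).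
  rewrite dintCZ//; last by apply: bmCM => //; exact: bmC_real.
  by rewrite rmorphMn /= -mulr_natl => /(mulfI nz).
apply/funext => s; rewrite natrB// mulrCA -(RIC_det_kern D)// -RICZ//.
  congr RIC; apply/funext => y; congr (_%:C * _); rewrite /f'; congr f.
  exact: val_inj.
by apply: bmC_comp (bK n.+1); apply: measurable_cons_tuple => //; exact: measurable_id.
Qed.

End Determinantal.

(** * Sums over the integers *)

Section SymmetricSums.
Context {R : realType}.
Implicit Types u c : int -> R.

Definition zpart u (M : nat) : R :=
  \sum_(k < (2 * M).+1) u (k%:Z - M%:Z)%R.

Lemma zpart0 u : zpart u 0 = u 0.
Proof. by rewrite /zpart muln0 big_ord1 subrr. Qed.

Lemma zpartS u M : zpart u M.+1 = zpart u M + (u M.+1%:Z + u (- M.+1%:Z)).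
Proof.
rewrite /zpart mulnS add2n big_ord_recl big_ord_recr /= addrCA.
congr (_ + _); last first.
  by rewrite addrC; congr (u _ + u _); rewrite ?sub0r // /bump /=; lia.
by apply: eq_bigr => k _; congr u; rewrite /bump /=; lia.
Qed.

Lemma zpartD u v M : zpart (fun n => u n + v n) M = zpart u M + zpart v M.
Proof. exact: big_split. Qed.

Lemma zpartZ a u M : zpart (fun n => a * u n) M = a * zpart u M.
Proof. by rewrite /zpart mulr_sumr. Qed.

(** The majorants: for nonnegative terms, convergence of the symmetric partial sums amounts to
    absolute summability over the integers. *)
Definition zsummable c := (forall n, 0 <= c n) /\ cvgn (zpart c).

Lemma nondecreasing_zpart c : (forall n, 0 <= c n) ->
  {homo zpart c : n m / (n <= m)%N >-> n <= m}.
Proof.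
move=> c0; apply: homo_leq => // [x y z|n]; first exact: le_trans.
by rewrite zpartS lerDl addr_ge0.
Qed.

Lemma zsummable_le c u : zsummable c -> (forall n, 0 <= u n <= c n) -> zsummable u.
Proof.
move=> [c0 cc] uc; have u0 n : 0 <= u n by have /andP[] := uc n.
split => //; apply: nondecreasing_is_cvgn; first exact: nondecreasing_zpart.
exists (zsumR c) => _ [M _ <-].
apply: le_trans (nondecreasing_cvgn_le (nondecreasing_zpart c c0) cc M).
by apply: ler_sum => k _; have /andP[] := uc (k%:Z - M%:Z).
Qed.

Lemma zsummableZ a c : 0 <= a -> zsummable c -> zsummable (fun n => a * c n).
Proof.
move=> a0 [c0 cc]; split=> [n|]; first exact: mulr_ge0.
rewrite (_ : zpart _ = fun M => a * zpart c M); first exact: is_cvgMr.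
by apply/funext => M; rewrite zpartZ.
Qed.

Section Dominated.
Variables c : int -> R.
Hypothesis sc : zsummable c.

(** Write [u] as [(u + c) - c], where [u + c] lies between [0] and [2 * c]. *)
Lemma is_cvg_zpart u : (forall n, `|u n| <= c n) -> cvgn (zpart u).
Proof.
move=> uc; have [c0 cc] := sc.
have [_ h] : zsummable (fun n => u n + c n).
  apply: (zsummable_le (fun n => 2 * c n)); first by apply: zsummableZ.
  by move=> n; have := uc n; rewrite ler_norml => /andP[h1 h2]; apply/andP; split; lra.
rewrite (_ : zpart u = zpart (fun n => u n + c n) \- zpart c).
  exact: is_cvgB.
by apply/funext => M /=; rewrite zpartD addrK.
Qed.

Lemma cvg_zpart u : (forall n, `|u n| <= c n) -> zpart u M @[M --> \oo] --> zsumR u.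
Proof. by move=> uc; exact: is_cvg_zpart. Qed.

Lemma zsumRD u v : (forall n, `|u n| <= c n) -> (forall n, `|v n| <= c n) ->
  zsumR (fun n => u n + v n) = zsumR u + zsumR v.
Proof.
move=> uc vc; apply/cvg_lim => //.
rewrite [X in X @ _ --> _](_ : _ = zpart u \+ zpart v).
  by apply: cvgD; exact: cvg_zpart.
by apply/funext => M; exact: zpartD.
Qed.

Lemma zsumRZ a u : (forall n, `|u n| <= c n) ->
  zsumR (fun n => a * u n) = a * zsumR u.
Proof.
move=> uc; apply/cvg_lim => //.
rewrite [X in X @ _ --> _](_ : _ = fun M => a * zpart u M).
  by apply: cvgMr; exact: cvg_zpart.
by apply/funext => M; exact: zpartZ.
Qed.

(** Both [c - u] and [c + u] are nonnegative, so their partial sums stay below their limits. The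
    bound depends on [u] only through [c], which gives uniform convergence for families of
    series. *)
Lemma zsumR_tail u M : (forall n, `|u n| <= c n) ->
  `|zsumR u - zpart u M| <= zsumR c - zpart c M.
Proof.
move=> uc; have [c0 _] := sc.
have cc n : `|c n| <= c n by rewrite ger0_norm.
have half v : (forall n, `|v n| <= c n) ->
    zsumR v - zpart v M <= zsumR c - zpart c M.
  move=> vc.
  have nc n : `|-1 * v n| <= c n by rewrite mulN1r normrN.
  have d0 n : 0 <= c n + -1 * v n.
    by have := vc n; rewrite ler_norml => /andP[h1 h2]; lra.
  have dc : cvgn (zpart (fun n => c n + -1 * v n)).
    rewrite (_ : zpart _ = zpart c \+ zpart (fun n => -1 * v n)).
      by apply: is_cvgD; exact: is_cvg_zpart.
    by apply/funext => k; exact: zpartD.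
  have := nondecreasing_cvgn_le (nondecreasing_zpart _ d0) dc M.
  rewrite -[limn _]/(zsumR _) zsumRD// zsumRZ// zpartD zpartZ; lra.
rewrite ler_norml half// andbT.
have nc n : `|-1 * u n| <= c n by rewrite mulN1r normrN.
by have := half _ nc; rewrite zsumRZ// zpartZ; lra.
Qed.

Lemma zsumR_norm u : (forall n, `|u n| <= c n) -> `|zsumR u| <= zsumR c.
Proof.
move=> uc; have := zsumR_tail u 0 uc; rewrite !zpart0 => h.
have := ler_normD (zsumR u - u 0) (u 0); rewrite subrK => h'.
by have := uc 0; lra.
Qed.

Lemma zsumR_gt0 : (forall n, 0 < c n) -> 0 < zsumR c.
Proof.
move=> c0; have [cn cc] := sc; apply: lt_le_trans (c0 0) _; rewrite -zpart0.
exact: (nondecreasing_cvgn_le (nondecreasing_zpart _ cn) cc 0).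
Qed.

End Dominated.

Lemma zsumR_delta (x : R) (m : int) : zsumR (fun n => (n == m)%:R * x) = x.
Proof.
apply/cvg_lim => //; apply: (@cvg_near_cst).
exists `|m|%N => // M /= mM.
suff E : zpart (fun n => (n == m)%:R * x) M = x by exact: E.
have km : (absz (m + M%:Z)%R < (2 * M).+1)%N by lia.
rewrite /zpart (bigD1 (Ordinal km))//= big1 => [|k /eqP kk].
  rewrite (_ : _ == _ = true) ?mul1r ?addr0//; apply/eqP; lia.
rewrite (_ : _ == _ = false) ?mul0r//; apply/eqP => kE; apply: kk.
by apply: val_inj => /=; lia.
Qed.

(** Each [c n] is at most the whole sum of [c], so the product is dominated by a constant multiple
    of [c']. *)
Lemma zsummableM c c' : zsummable c -> zsummable c' ->
  zsummable (fun n => c n * c' n).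
Proof.
move=> sc sc'; have [c0 _] := sc; have [c0' _] := sc'.
have cB n : c n <= zsumR c.
  rewrite -[leLHS](zsumR_delta _ n); apply: le_trans (ler_norm _) _.
  apply: zsumR_norm => // m; case: eqP => [->|_]; rewrite ?mul1r ?mul0r ?normr0//.
  by rewrite ger0_norm.
apply: (zsummable_le (fun n => zsumR c * c' n)).
  by apply: zsummableZ => //; exact: le_trans (cB 0).
by move=> n; rewrite mulr_ge0//= ler_wpM2r.
Qed.

End SymmetricSums.

(** * Termwise integration of dominated series *)

Section IntegralOfSums.
Context {R : realType}.
Local Notation C := R[i].
Variables (D : set R) (mD : measurable D) (fD : (lebesgue_measure D < +oo)%E).

Lemma bm_zpart (u : int -> R -> R) M : (forall n, bm (u n)) ->
  bm (fun x => zpart (u^~ x) M).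
Proof. by move=> bu; apply: bm_sum. Qed.

Lemma RI_zpart (u : int -> R -> R) M : (forall n, bm (u n)) ->
  RI D (fun x => zpart (u^~ x) M) = zpart (fun n => RI D (u n)) M.
Proof.
move=> bu; elim: M => [|M IH].
  by rewrite zpart0; under eq_fun do rewrite zpart0.
rewrite zpartS -IH; under eq_fun do rewrite zpartS.
by rewrite !RID//; first [exact: bmD|exact: bm_zpart].
Qed.

Lemma bm_zsumR (c : int -> R) (u : int -> R -> R) : zsummable c ->
  (forall n, bm (u n)) -> (forall n x, `|u n x| <= c n) ->
  bm (fun x => zsumR (u^~ x)).
Proof.
move=> sc bu uc; split; last by exists (zsumR c) => x; exact: zsumR_norm.
apply: (@measurable_fun_cvg _ _ _ _ (fun M x => zpart (u^~ x) M)).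
  by move=> M; case: (bm_zpart u M bu).
by move=> x _; apply: (cvg_zpart c sc).
Qed.

Lemma RI_zsumR (c : int -> R) (u : int -> R -> R) : zsummable c ->
  (forall n, bm (u n)) -> (forall n x, `|u n x| <= c n) ->
  RI D (fun x => zsumR (u^~ x)) = zsumR (fun n => RI D (u n)).
Proof.
move=> sc bu uc; apply/esym/cvg_lim => //.
have bs := bm_zsumR c u sc bu uc.
set L := RI D _; rewrite [X in X @ _ --> _](_ : _ =
    fun M => RI D (fun x => zpart (u^~ x) M)); last first.
  by apply/funext => M; rewrite RI_zpart.
(* The tail of the majorant times the length of the domain bounds the integrated remainder. *)
pose e M := (zsumR c - zpart c M) * fine (lebesgue_measure D).
have e0 : e M @[M --> \oo] --> (0 : R).
  rewrite -[X in _ --> X](mul0r (fine (lebesgue_measure D))).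
  apply: cvgMl; rewrite -(subrr (zsumR c)); apply: cvgB; first exact: cvg_cst.
  by have [_] := sc.
have bd M : `|RI D (fun x => zpart (u^~ x) M) - L| <= e M.
  rewrite distrC /L -[X in _ - X]mul1r -mulNr -RIZ//; last exact: bm_zpart.
  rewrite -RID//; last by apply: bmM; [exact: bm_cst|exact: bm_zpart].
  apply: RI_bound => // [|x].
    by apply: bmD => //; apply: bmM; [exact: bm_cst|exact: bm_zpart].
  by rewrite mulN1r; apply: zsumR_tail.
apply: (@squeeze_cvgr _ _ _ _ (fun M => L - e M) (fun M => L + e M)).
- by apply: nearW => M; have := bd M; rewrite ler_norml => /andP[h1 h2]; apply/andP; split; lra.
- by rewrite -[X in _ --> X]subr0; apply: cvgB => //; exact: cvg_cst.
- by rewrite -[X in _ --> X]addr0; apply: cvgD => //; exact: cvg_cst.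
Qed.

(** The two components are bounded separately because [zsumC] sums them separately. *)
Definition domC (c : int -> R) (u : int -> C) := forall n,
  `|reC (u n)| <= c n /\ `|imC (u n)| <= c n.

Lemma zsumCZ (c : int -> R) a (u : int -> C) : zsummable c -> domC c u ->
  zsumC (fun n => a * u n) = a * zsumC u.
Proof.
move=> sc uc.
have ur n : `|reC (u n)| <= c n by case: (uc n).
have ui n : `|imC (u n)| <= c n by case: (uc n).
pose b := `|reC a| + `|imC a|.
have sb : zsummable (fun n => b * c n) by apply: zsummableZ; rewrite ?addr_ge0.
have le (x y : R) n : `|x| <= b -> `|y| <= c n -> `|x * y| <= b * c n.
  by move=> xb yc; rewrite normrM ler_pM.
have ra : `|reC a| <= b by rewrite lerDl.
have ia : `|imC a| <= b by rewrite lerDr.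
have ia' : `|- imC a| <= b by rewrite normrN.
apply: eq_re_im; rewrite ?reCM ?imCM /=.
  under eq_fun do rewrite reCM -mulNr.
  rewrite (zsumRD _ sb)//; [|by move=> n; exact: le..].
  by rewrite !(zsumRZ c)// mulNr.
under eq_fun do rewrite imCM.
rewrite (zsumRD _ sb)//; [|by move=> n; exact: le..].
by rewrite !(zsumRZ c).
Qed.

Lemma zsumCD (c : int -> R) (u v : int -> C) : zsummable c -> domC c u -> domC c v ->
  zsumC (fun n => u n + v n) = zsumC u + zsumC v.
Proof.
move=> sc uc vc; apply: eq_re_im; rewrite ?reCD ?imCD /=.
  under eq_fun do rewrite reCD.
  by apply: (zsumRD c sc) => n; [case: (uc n)|case: (vc n)].
under eq_fun do rewrite imCD.
by apply: (zsumRD c sc) => n; [case: (uc n)|case: (vc n)].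
Qed.

Lemma zsumC_real (a : int -> R) : zsumC (fun n => (a n)%:C) = (zsumR a)%:C.
Proof.
apply: eq_re_im => //=.
have := zsumR_delta (0 : R) 0; rewrite (_ : (fun n => _) = fun=> 0)//.
by apply/funext => n; rewrite mulr0.
Qed.

Lemma bmC_zsumC c (u : int -> R -> C) : zsummable c ->
  (forall n, bmC (u n)) -> (forall x, domC c (u^~ x)) ->
  bmC (fun x => zsumC (u^~ x)).
Proof.
move=> sc bu uc; split.
  apply: (bm_zsumR c (fun n x => reC (u n x))) => // [n|n x].
    by case: (bu n).
  by case: (uc x n).
apply: (bm_zsumR c (fun n x => imC (u n x))) => // [n|n x].
  by case: (bu n).
by case: (uc x n).
Qed.

Lemma RIC_zsumC c (u : int -> R -> C) : zsummable c ->
  (forall n, bmC (u n)) -> (forall x, domC c (u^~ x)) ->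
  RIC D (fun x => zsumC (u^~ x)) = zsumC (fun n => RIC D (u n)).
Proof.
move=> sc bu uc; apply: eq_re_im => /=.
  apply: (RI_zsumR c (fun n x => reC (u n x))) => // [n|n x].
    by case: (bu n).
  by case: (uc x n).
apply: (RI_zsumR c (fun n x => imC (u n x))) => // [n|n x].
  by case: (bu n).
by case: (uc x n).
Qed.

Lemma zsumC_norm c (u : int -> C) : zsummable c -> domC c u ->
  `|reC (zsumC u)| <= zsumR c /\ `|imC (zsumC u)| <= zsumR c.
Proof. by move=> sc uc; split; apply: zsumR_norm => // n; case: (uc n). Qed.

Lemma normCM_bound (a b : C) (A B : R) :
  `|reC a| <= A -> `|imC a| <= A -> `|reC b| <= B -> `|imC b| <= B ->
  `|reC (a * b)| <= 2 * A * B /\ `|imC (a * b)| <= 2 * A * B.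
Proof.
move=> a1 a2 b1 b2.
have E : 2 * A * B = A * B + A * B by ring.
split; rewrite ?reCM ?imCM E.
  by rewrite (le_trans (ler_normB _ _))// !normrM lerD// ler_pM.
by rewrite (le_trans (ler_normD _ _))// !normrM lerD// ler_pM.
Qed.

Section Biorthogonality.
Variables (c c' : int -> R) (u v : int -> R -> C) (al ep : R) (sigma : int -> int).
Hypotheses (sc : zsummable c) (sc' : zsummable c').
Hypotheses (bu : forall n, bmC (u n)) (bv : forall n, bmC (v n)).
Hypotheses (u1 : forall x, domC (fun=> 1) (u^~ x))
           (v1 : forall x, domC (fun=> 1) (v^~ x)).
(** [al] weighs the diagonal pairs and [ep] the pairs of opposite frequency, related by [sigma]. The
    factor [ep] in [csigma] requires reflection symmetry of the coefficients only when such pairs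
    contribute. *)
Hypothesis uv : forall n m, RIC D (fun x => u n x * v m x) =
  (al * (n == m)%:R + ep * (n == sigma m)%:R)%:C.
Hypothesis csigma : forall m, ep * c (sigma m) = ep * c m.

Lemma domC_scale (a : int -> R) (w : int -> C) : (forall n, 0 <= a n) ->
  domC (fun=> 1) w -> domC a (fun n => (a n)%:C * w n).
Proof.
move=> a0 w1 n; have [h1 h2] := w1 n.
by rewrite reCM imCM /= !mul0r subr0 addr0 !normrM (ger0_norm (a0 n)) !ler_piMr.
Qed.

Let F x := zsumC (fun n => (c n)%:C * u n x).

Let bF : bmC F.
Proof.
apply: (bmC_zsumC c) => // [n|x]; first by apply: bmCM => //; exact: bmC_cst.
by apply: domC_scale => //; case: sc.
Qed.

Let RIC_F m : RIC D (fun x => F x * v m x) = ((al + ep) * c m)%:C.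
Proof.
have [c0 _] := sc.
have s2 : zsummable (fun n => 2 * c n) by exact: zsummableZ.
have d2 x : domC (fun n => 2 * c n) (fun n => (c n)%:C * (u n x * v m x)).
  move=> n; have [h1 h2] := u1 x n; have [h3 h4] := v1 x m.
  have [h5 h6] := normCM_bound _ _ _ _ h1 h2 h3 h4.
  rewrite (reCM (c n)%:C) (imCM (c n)%:C) /= !mul0r subr0 addr0 !normrM.
  move: h5 h6; rewrite (ger0_norm (c0 n)) !mulr1 => h5 h6.
  by rewrite [2 * _]mulrC !ler_wpM2l.
rewrite (_ : (fun x => _) = fun x => zsumC (fun n => (c n)%:C * (u n x * v m x))).
  rewrite (RIC_zsumC (fun n => 2 * c n) (fun n x => (c n)%:C * (u n x * v m x)))//.
    rewrite (_ : (fun n => _) = fun n => (c n * (al * (n == m)%:R +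
        ep * (n == sigma m)%:R))%:C); last first.
      by apply/funext => n; rewrite RICZ ?uv ?rmorphM//; exact: bmCM.
    rewrite zsumC_real; congr (_%:C).
    pose b := `|al| + `|ep|.
    have sb : zsummable (fun n => b * c n) by apply: zsummableZ; rewrite ?addr_ge0.
    rewrite (_ : (fun n => _) = fun n => (n == m)%:R * (al * c m) +
        (n == sigma m)%:R * (ep * c (sigma m))).
      rewrite (zsumRD _ sb).
      - by rewrite !zsumR_delta csigma mulrDl.
      - move=> n; case: eqP => [->|_]; last by rewrite mul0r normr0 mulr_ge0// addr_ge0.
        by rewrite mul1r normrM (ger0_norm (c0 _)) ler_wpM2r// lerDl.
      - move=> n; case: eqP => [->|_]; last by rewrite mul0r normr0 mulr_ge0// addr_ge0.
        by rewrite mul1r normrM (ger0_norm (c0 _)) ler_wpM2r// lerDr.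
    apply/funext => n.
    have E k : (n == k)%:R * c n = (n == k)%:R * c k by case: eqP => [->|_]; rewrite ?mul0r.
    transitivity (al * ((n == m)%:R * c n) + ep * ((n == sigma m)%:R * c n)); first by ring.
    by rewrite !E; ring.
  by move=> n; apply: bmCM; [exact: bmC_cst|exact: bmCM].
apply/funext => x; rewrite mulrC /F -(zsumCZ c)//; last exact: domC_scale.
by congr zsumC; apply/funext => n; ring.
Qed.

(** No double series is needed: integrating the first series against a single [v m] leaves
    [(al + ep) * c m], and the second series is then integrated termwise with the first sum as a
    bounded factor. *)
Lemma RIC_zsumC_mul :
  RIC D (fun x => zsumC (fun n => (c n)%:C * u n x) *
                  zsumC (fun n => (c' n)%:C * v n x)) =
  ((al + ep) * zsumR (fun n => c n * c' n))%:C.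
Proof.
have scc := zsummableM _ _ sc sc'; have [c0 _] := sc; have [c0' _] := sc'.
set B := zsumR c.
have FB x : `|reC (F x)| <= B /\ `|imC (F x)| <= B.
  by apply: zsumC_norm => //; exact: domC_scale.
have B0 : 0 <= B by have [h _] := FB 0; exact: le_trans h.
have s2 : zsummable (fun n => 2 * B * c' n) by apply: zsummableZ => //; rewrite mulr_ge0.
have d2 x : domC (fun n => 2 * B * c' n) (fun n => F x * ((c' n)%:C * v n x)).
  move=> n; have [h1 h2] := FB x; have [h3 h4] := domC_scale _ _ c0' (v1 x) n.
  exact: normCM_bound.
rewrite (_ : (fun x => _) = fun x => zsumC (fun n => F x * ((c' n)%:C * v n x))).
  rewrite (RIC_zsumC (fun n => 2 * B * c' n) (fun n x => F x * ((c' n)%:C * v n x)))//.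
    rewrite (_ : (fun n => _) = fun n => ((al + ep) * (c n * c' n))%:C).
      rewrite zsumC_real (zsumRZ _ scc)// => n.
      by rewrite ger0_norm// mulr_ge0.
    apply/funext => n.
    rewrite (_ : (fun x => _) = fun x => (c' n)%:C * (F x * v n x)).
      rewrite RICZ ?RIC_F//; last exact: bmCM.
      by rewrite -rmorphM; congr (_%:C); ring.
    by apply/funext => x; ring.
  by move=> n; apply: bmCM => //; apply: bmCM => //; exact: bmC_cst.
by apply/funext => x; rewrite (zsumCZ c')//; exact: domC_scale.
Qed.

End Biorthogonality.
End IntegralOfSums.

(** * Theta functions *)

Section ThetaSeries.
Context {R : realType}.
Local Notation C := R[i].
Implicit Types (y s z : R) (n : int).

Definition half_int n : R := n%:~R - 2^-1.

(** Modulus of the [n]-th theta term at [tau = i y] and [v = s tau + z] with real [z]; the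
    dependence on [z] is a pure phase. *)
Definition theta_coef y s n : R := expR (- (pi * y * (half_int n ^+ 2 + 2 * s * half_int n))).

Lemma theta_coef_gt0 y s n : 0 < theta_coef y s n.
Proof. exact: expR_gt0. Qed.

(** The exponent is linear in [y], so multiplying coefficients adds times; this is how the constants
    at time [ts] arise. *)
Lemma theta_coefM y y' s n : theta_coef y s n * theta_coef y' s n = theta_coef (y + y') s n.
Proof. by rewrite /theta_coef -expRD; congr expR; ring. Qed.

Lemma zsummable_geometric (q : R) : 0 <= q < 1 ->
  zsummable (fun n => q ^+ `|n|%N).
Proof.
move=> /andP[r0 r1]; have p0 k : 0 <= q ^+ k by exact: exprn_ge0.
split => //; apply: nondecreasing_is_cvgn; first exact: nondecreasing_zpart.
exists (2 / (1 - q)) => _ [M _ <-].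
have d0 : 0 < 1 - q by rewrite subr_gt0.
rewrite ler_pdivlMr//.
(* The left side equals [1 + q - 2 * q ^+ M.+1]; keeping the decaying term in the bound lets the
   induction close. *)
suff H : zpart (fun n => q ^+ `|n|%N) M * (1 - q) <= 2 - 2 * q ^+ M.+1.
  by have := p0 M.+1; lra.
elim: M => [|M IH]; first by rewrite zpart0 expr0 expr1; lra.
rewrite zpartS abszN absz_nat mulrDl [q ^+ M.+2]exprSr; nra.
Qed.

Lemma zsummable_theta_coef y s : 0 < y -> zsummable (theta_coef y s).
Proof.
move=> y0.
(* [K] completes the square: it leaves at least [(|m| - (1 + |s|)) ^+ 2] in the quadratic form after
   [|m|] is removed, so Gaussian decay is traded for a geometric majorant. *)
pose K := expR (pi * y * ((1 + `|s|) ^+ 2 + `|s|)).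
have q : 0 <= expR (- (pi * y)) < 1.
  by rewrite expR_ge0 /= -expR0 ltr_expR oppr_lt0 mulr_gt0// pi_gt0.
apply: (zsummable_le (fun n => K * expR (- (pi * y)) ^+ `|n|%N)).
  by apply: zsummableZ; [exact: expR_ge0|exact: zsummable_geometric].
move=> n; rewrite expR_ge0 /= /K /theta_coef -expRM_natl -expRD ler_expR.
have -> : `|n|%N%:R = `|n%:~R| :> R by rewrite -intr_norm natr_absz.
rewrite /half_int; set m : R := n%:~R.
suff h : 0 <= (m - 2^-1) ^+ 2 + 2 * s * (m - 2^-1) - `|m| + ((1 + `|s|) ^+ 2 + `|s|).
  have := mulr_ge0 (ltW (mulr_gt0 (pi_gt0 R) y0)) h; lra.
have mm : m ^+ 2 = `|m| ^+ 2 by rewrite real_normK// num_real.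
have sm : - (`|s| * `|m|) <= s * m.
  by have := lerNnormlW (lexx `|s * m|); rewrite normrM.
have m1 := ler_norm m; have s1 := ler_norm s.
have : 0 <= (`|m| - (1 + `|s|)) ^+ 2 by exact: sqr_ge0.
have -> : (m - 2^-1) ^+ 2 = m ^+ 2 - m + 4^-1 by field.
by rewrite mm; nra.
Qed.

Definition cis (a : R) : C := cos a +i* sin a.

Lemma cisD a b : cis (a + b) = cis a * cis b.
Proof. by apply: eq_re_im; rewrite /cis ?reCM ?imCM /= ?cosD ?sinD//; ring. Qed.

Lemma conj_cis a : (conjc (cis a)) = cis (- a).
Proof. by rewrite /cis cosN sinN. Qed.

Lemma cexpE (a b : R) : cexp (a +i* b) = (expR a)%:C * cis b.
Proof. by []. Qed.

Lemma half_intC n : n%:~R - 2^-1 = (half_int n)%:C :> C.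
Proof. by rewrite /half_int rmorphB /= rmorph_int fmorphV rmorph_nat. Qed.

Lemma theta_termE y s z n :
  theta_term (s%:C * (0 +i* y) + z%:C) (0 +i* y) n =
  (theta_coef y s n)%:C * cis (2 * pi * z * half_int n).
Proof.
rewrite /theta_term half_intC -cexpE; congr cexp.
rewrite -[2 : C](rmorph_nat (@real_complex R)) expr2.
by apply: eq_re_im => /=; field.
Qed.

Lemma cexp_phase s z :
  cexp (2%:C * pi%:C * iC * s%:C * z%:C) = cis (2 * pi * s * z).
Proof.
rewrite -[RHS]mul1r -(rmorph1 (@real_complex R)) -expR0 -cexpE; congr cexp.
by apply: eq_re_im => /=; ring.
Qed.

Lemma domC_cis (a : int -> R) : domC (fun=> 1) (fun n => cis (a n)).
Proof. by move=> n; split => /=; [exact: cos_max|exact: sin_max]. Qed.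

Definition theta_sum (y s : R) (u : int -> C) : C := zsumC (fun n => (theta_coef y s n)%:C * u n).

Lemma thetaE y s z : 0 < y ->
  theta2 (s%:C * (0 +i* y) + z%:C) (0 +i* y) = theta_sum y s (fun n => cis (2 * pi * z * half_int n)).
Proof. by move=> y0; congr zsumC; apply/funext => n; rewrite theta_termE. Qed.

Lemma theta_sumZ a y s u : 0 < y -> domC (fun=> 1) u -> a * theta_sum y s u = theta_sum y s (fun n => a * u n).
Proof.
move=> y0 u1; rewrite /theta_sum -(zsumCZ (theta_coef y s)).
- by congr zsumC; apply/funext => n; ring.
- exact: zsummable_theta_coef.
- by apply: domC_scale => // n; rewrite ltW// theta_coef_gt0.
Qed.

(** The exponential prefactor shifts every frequency by [s], which turns the theta series into a
    Fourier series with frequencies [half_int n + s]. *)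
Lemma ThetaAE y s z : 0 < y ->
  ThetaA s z%:C (0 +i* y) = theta_sum y s (fun n => cis (2 * pi * z * (half_int n + s))).
Proof.
move=> y0; rewrite /ThetaA cexp_phase thetaE// theta_sumZ//; last exact: domC_cis.
by congr theta_sum; apply/funext => n; rewrite -cisD; congr cis; ring.
Qed.

Definition alt_sign n : R := (-1) ^ n.

Lemma alt_signC n : (alt_sign n)%:C = (-1) ^ n.
Proof. by case: n => k; rewrite /alt_sign /exprz ?fmorphV rmorphXn /= rmorphN rmorph1. Qed.

Lemma norm_alt_sign n : `|alt_sign n| = 1.
Proof. by case: n => k; rewrite /alt_sign /exprz /= ?normfV normrX normrN1 expr1n ?invr1. Qed.

Lemma domC_cst_scale (a : int -> C) (u : int -> R) : domC (fun=> 1) a ->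
  (forall n, `|u n| = 1) -> domC (fun=> 1) (fun n => (u n)%:C * a n).
Proof.
move=> a1 u1 n; have [h1 h2] := a1 n.
by rewrite reCM imCM /= !mul0r subr0 addr0 !normrM u1 !mul1r.
Qed.

Lemma theta1E y s z : 0 < y ->
  cexp (2%:C * pi%:C * iC * s%:C * z%:C) * theta1 (s%:C * (0 +i* y) + z%:C) (0 +i* y) =
  iC * theta_sum y s (fun n => (alt_sign n)%:C * cis (2 * pi * z * (half_int n + s))).
Proof.
move=> y0; rewrite cexp_phase /theta1 mulrCA; congr (_ * _).
have -> : zsumC (fun n => (-1) ^ n * theta_term (s%:C * (0 +i* y) + z%:C) (0 +i* y) n)
   = theta_sum y s (fun n => (alt_sign n)%:C * cis (2 * pi * z * half_int n)).
  by congr zsumC; apply/funext => n; rewrite theta_termE alt_signC; ring.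
rewrite theta_sumZ//; last by apply: domC_cst_scale; [exact: domC_cis|exact: norm_alt_sign].
congr theta_sum; apply/funext => n; rewrite mulrCA -cisD; congr (_ * cis _); ring.
Qed.

Lemma theta_sumD y s u v : 0 < y -> domC (fun=> 1) u -> domC (fun=> 1) v ->
  theta_sum y s u + theta_sum y s v = theta_sum y s (fun n => u n + v n).
Proof.
move=> y0 u1 v1; rewrite /theta_sum -(zsumCD (theta_coef y s)).
- by congr zsumC; apply/funext => n; ring.
- exact: zsummable_theta_coef.
- by apply: domC_scale => // n; rewrite ltW// theta_coef_gt0.
- by apply: domC_scale => // n; rewrite ltW// theta_coef_gt0.
Qed.

Lemma domC_real (u : int -> R) : (forall n, `|u n| <= 1) ->
  domC (fun=> 1) (fun n => (u n)%:C).
Proof. by move=> u1 n; rewrite /= normr0 ler01. Qed.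

Let phaseN s z : - (2%:C * pi%:C * iC * s%:C * z%:C) =
  2%:C * pi%:C * iC * s%:C * (- z)%:C :> C.
Proof. by rewrite rmorphN mulrN. Qed.

Let cis_sum a : cis a + cis (- a) = 2 * (cos a)%:C.
Proof. by apply: eq_re_im; rewrite -[2 : C](rmorph_nat (@real_complex R)) /cis /= ?cosN ?sinN; ring. Qed.

Let cis_diff a : cis a - cis (- a) = 2 * iC * (sin a)%:C.
Proof. by apply: eq_re_im; rewrite -[2 : C](rmorph_nat (@real_complex R)) /cis /= ?cosN ?sinN; ring. Qed.

Let zN s z n : 2 * pi * - z * (half_int n + s) = - (2 * pi * z * (half_int n + s)).
Proof. by ring. Qed.

Let domCN u : domC (fun=> 1 : R) u -> domC (fun=> 1) (fun n => - u n).
Proof. by move=> u1 n; have := u1 n; case: (u n) => a b /=; rewrite !normrN. Qed.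

Let theta_sumN y s u : 0 < y -> domC (fun=> 1) u -> - theta_sum y s u = theta_sum y s (fun n => - u n).
Proof.
move=> y0 u1; rewrite -mulN1r theta_sumZ//; congr theta_sum; apply/funext => n; by rewrite mulN1r.
Qed.

(** The subtracted term is the first one at [- z]. The constant [-2] is the product of the [i] in
    [theta1] and the [2 i] in the difference of conjugate exponentials. *)
Lemma ThetaBE y s z : 0 < y -> ThetaB s z%:C (0 +i* y) =
  (-2) * theta_sum y s (fun n => (alt_sign n * sin (2 * pi * z * (half_int n + s)))%:C).
Proof.
move=> y0; have ds a : domC (fun=> 1) (fun n => (alt_sign n)%:C * cis (a n)).
  by apply: domC_cst_scale; [exact: domC_cis|exact: norm_alt_sign].
rewrite /ThetaB phaseN -[_ - z%:C]/(_ + - z%:C) -rmorphN !theta1E// -mulrBr.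
rewrite theta_sumN// theta_sumD//; last exact: domCN.
transitivity (iC * theta_sum y s (fun n => 2 * iC *
    (alt_sign n * sin (2 * pi * z * (half_int n + s)))%:C)).
  congr (_ * theta_sum _ _ _); apply/funext => n.
  by rewrite zN -mulrBr cis_diff rmorphM; ring.
rewrite -theta_sumZ//; last first.
  by apply: domC_real => n; rewrite normrM norm_alt_sign mul1r sin_max.
rewrite mulrA; congr (_ * _).
by rewrite -[2 : C](rmorph_nat (@real_complex R)); apply: eq_re_im => /=; ring.
Qed.

Lemma ThetaCE y s z : 0 < y -> ThetaC s z%:C (0 +i* y) =
  2 * iC * theta_sum y s (fun n => (sin (2 * pi * z * (half_int n + s)))%:C).
Proof.
move=> y0; rewrite -[LHS]/(ThetaA s z%:C (0 +i* y) - _) ThetaAE//.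
rewrite phaseN -[_ - z%:C]/(_ + - z%:C) -rmorphN -[X in _ - X]/(ThetaA _ _ _) ThetaAE//.
rewrite theta_sumN//; last exact: domC_cis.
rewrite theta_sumD//; [|exact: domC_cis|exact/domCN/domC_cis].
rewrite theta_sumZ//; last by apply: domC_real => n; rewrite sin_max.
by congr theta_sum; apply/funext => n; rewrite zN cis_diff.
Qed.

Lemma ThetaDE y s z : 0 < y -> ThetaD s z%:C (0 +i* y) =
  2 * theta_sum y s (fun n => (cos (2 * pi * z * (half_int n + s)))%:C).
Proof.
move=> y0; rewrite -[LHS]/(ThetaA s z%:C (0 +i* y) + _) ThetaAE//.
rewrite phaseN -[_ - z%:C]/(_ + - z%:C) -rmorphN -[X in _ + X]/(ThetaA _ _ _) ThetaAE//.
rewrite theta_sumD//; [|exact: domC_cis..].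
rewrite theta_sumZ//; last by apply: domC_real => n; rewrite cos_max.
by congr theta_sum; apply/funext => n; rewrite zN cis_sum.
Qed.

Lemma theta2_real y s : 0 < y ->
  theta2 (s%:C * (0 +i* y)) (0 +i* y) = (zsumR (theta_coef y s))%:C.
Proof.
move=> y0; have := thetaE y s 0 y0; rewrite rmorph0 addr0 => ->.
rewrite -zsumC_real; congr zsumC; apply/funext => n.
by rewrite mulr0 mul0r /cis cos0 sin0 mulr1.
Qed.

End ThetaSeries.

(** * Biorthogonality *)

Section TrigIntegrals.
Context {R : realType}.
Implicit Types (m : int) (r L x k : R).

Lemma sin_int_pi m : sin (m%:~R * pi) = 0 :> R.
Proof.
have H (k : nat) : sin (k%:R * pi) = 0 :> R.
  elim: k => [|k IH]; first by rewrite mul0r sin0.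
  by rewrite -natr1 mulrDl mul1r sinDpi IH oppr0.
by case: m => k; rewrite ?NegzE ?mulrNz ?mulNr ?sinN -pmulrn H ?oppr0.
Qed.

Lemma cos_int_2pi m : cos (m%:~R * (2 * pi)) = 1 :> R.
Proof.
have -> : m%:~R * (2 * pi) = (m%:~R * pi) *+ 2 :> R by rewrite -mulr_natr; ring.
by rewrite cos_mulr2n cos2sin2 sin_int_pi expr0n /= subr0 mulr2n; ring.
Qed.

Lemma Rintegral_derive (F f : R -> R) (a b : R) : a < b ->
  (forall x, is_derive x 1 F (f x)) -> continuous f ->
  Rintegral lebesgue_measure `[a, b] f = F b - F a.
Proof.
move=> ab dF cf; have cF : continuous F.
  by move=> x; apply/differentiable_continuous/derivable1_diffP.
rewrite /Rintegral (@continuous_FTC2 R f F)//.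
- exact: continuous_subspaceT.
- split; first by move=> x _.
    exact/cvg_at_right_filter/cF.
  exact/cvg_at_left_filter/cF.
- by move=> x _; rewrite derive1E; have [_ ->] := dF x.
Qed.

Lemma integral_cos k L : 0 < L -> k != 0 ->
  Rintegral lebesgue_measure `[0, L] (fun x => cos (k * x)) = sin (k * L) / k.
Proof.
move=> L0 k0; transitivity (k^-1 * sin (k * L) - k^-1 * sin (k * 0)); last first.
  by rewrite mulr0 sin0 mulr0 subr0 mulrC.
apply: (Rintegral_derive (fun x => k^-1 * sin (k * x))) => //.
- by move=> x; apply: is_derive_eq; rewrite /GRing.scale /=; field.
- move=> x; apply: continuous_comp; last exact: continuous_cos.
  exact: mulrl_continuous.
Qed.

Lemma integral_sin k L : 0 < L -> k != 0 ->
  Rintegral lebesgue_measure `[0, L] (fun x => sin (k * x)) = (1 - cos (k * L)) / k.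
Proof.
move=> L0 k0; transitivity (- k^-1 * cos (k * L) - - k^-1 * cos (k * 0)); last first.
  by rewrite mulr0 cos0; field.
apply: (Rintegral_derive (fun x => - k^-1 * cos (k * x))) => //.
- by move=> x; apply: is_derive_eq; rewrite /GRing.scale /=; field.
- move=> x; apply: continuous_comp; last exact: continuous_sin.
  exact: mulrl_continuous.
Qed.

Lemma bm_cos k : bm (fun x => cos (k * x)).
Proof.
split; last by exists 1 => x; exact: cos_max.
apply: continuous_measurable_fun => x.
by apply: continuous_comp; [exact: mulrl_continuous|exact: continuous_cos].
Qed.

Lemma bm_sin k : bm (fun x => sin (k * x)).
Proof.
split; last by exists 1 => x; exact: sin_max.
apply: continuous_measurable_fun => x.
by apply: continuous_comp; [exact: mulrl_continuous|exact: continuous_sin].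
Qed.

End TrigIntegrals.

Section Domains.
Context {R : realType}.

Lemma DomE (rt : RType) (r : R) : Dom rt r =
  if rt is TA then `[0, 2 * pi * r[%classic else `[0, pi * r]%classic.
Proof.
by case: rt; apply/seteqP; split => x; rewrite /Dom /= in_itv /=;
  (move=> [-> ->]//||move=> /andP[-> ->]).
Qed.

Lemma measurable_Dom (rt : RType) (r : R) : measurable (Dom rt r).
Proof. by rewrite DomE; case: rt; exact: measurable_itv. Qed.

Lemma Dom_lty (rt : RType) (r : R) : (lebesgue_measure (Dom rt r) < +oo)%E.
Proof.
by rewrite DomE; case: rt; rewrite /= lebesgue_measure_itv /=; case: ifP => _;
  rewrite ?ltry// -EFinD ltry.
Qed.

Lemma RI_Dom (rt : RType) (r : R) (g : R -> R) : bm g -> RI (Dom rt r) g =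
  Rintegral lebesgue_measure `[0, if rt is TA then 2 * pi * r else pi * r] g.
Proof.
rewrite /RI DomE; case: rt => // bg; apply: Rintegral_itv_bndo_bndc.
have fi : (lebesgue_measure `[0%R, (2 * pi * r)%R[%classic < +oo)%E.
  by have := Dom_lty TA r; rewrite DomE.
by apply: bm_integrable => //; exact: measurable_itv.
Qed.

Let meas0L (L : R) : 0 < L -> fine (lebesgue_measure `[0, L]%classic) = L.
Proof. by move=> L0; rewrite lebesgue_measure_itv /= lte_fin L0 -EFinD /= subr0. Qed.

(** The half period suffices for cosines, since [sin (m * pi)] vanishes; sines of odd frequency
    would survive. Outside type A only cosines occur, because products of two sines or two cosines
    are turned into sums. *)
Lemma RI_cos_half (rt : RType) (r : R) (m : int) : 0 < r -> rt <> TA ->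
  RI (Dom rt r) (fun x => cos (m%:~R / r * x)) = pi * r * (m == 0)%:R.
Proof.
move=> r0 rtA; have L0 : 0 < pi * r by rewrite mulr_gt0// pi_gt0.
rewrite RI_Dom; last exact: bm_cos.
rewrite (_ : (if rt is TA then _ else _) = pi * r); last by case: rt rtA.
have [->|m0] := eqVneq m 0.
  have cE : (fun x : R => cos ((0 : int)%:~R / r * x)) = fun=> 1.
    by apply/funext => x; rewrite mulr0z !mul0r cos0.
  by rewrite cE Rintegral_cst// meas0L// mul1r mulr1.
have mr : m%:~R / r != 0 by rewrite mulf_neq0 ?intr_eq0// invr_neq0// gt_eqF.
rewrite integral_cos// mulr0 (_ : _ * (pi * r) = m%:~R * pi) ?sin_int_pi ?mul0r//.
by field; rewrite gt_eqF.
Qed.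

Lemma RI_trig_full (r : R) (m : int) : 0 < r ->
  RI (Dom TA r) (fun x => cos (m%:~R / r * x)) = 2 * pi * r * (m == 0)%:R /\
  RI (Dom TA r) (fun x => sin (m%:~R / r * x)) = 0.
Proof.
move=> r0; have L0 : 0 < 2 * pi * r by rewrite !mulr_gt0// pi_gt0.
rewrite !RI_Dom; [|exact: bm_sin|exact: bm_cos].
have [->|m0] := eqVneq m 0.
  have cE : (fun x : R => cos ((0 : int)%:~R / r * x)) = fun=> 1.
    by apply/funext => x; rewrite mulr0z !mul0r cos0.
  have sE : (fun x : R => sin ((0 : int)%:~R / r * x)) = fun=> 0.
    by apply/funext => x; rewrite mulr0z !mul0r sin0.
  by rewrite cE sE !Rintegral_cst// meas0L// mul1r mulr1 mul0r.
have mr : m%:~R / r != 0 by rewrite mulf_neq0 ?intr_eq0// invr_neq0// gt_eqF.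
rewrite integral_cos// integral_sin//.
have -> : m%:~R / r * (2 * pi * r) = m%:~R * (2 * pi).
  by field; rewrite gt_eqF.
rewrite cos_int_2pi subrr mul0r mulr0; split => //.
have -> : m%:~R * (2 * pi) = (m * 2)%:~R * pi :> R by rewrite intrM; ring.
by rewrite sin_int_pi mul0r.
Qed.

End Domains.

(** * Arithmetic of the frequencies and the indices with doubled constants *)

Section RootSystems.
Context {R : realType}.

(* [Ncal_nat] and [Jshift] are integer forms of the paper's data: [Ncal = Ncal_nat] and
   [Jr j = j - Jshift / 2]. *)
Definition Ncal_nat (rt : RType) (N : nat) : nat :=
  match rt with
  | TA => N
  | TB => (2 * N).-1
  | TBv | TCv => 2 * N
  | TC => 2 * (N + 1)
  | TBC => 2 * N + 1
  | TD => 2 * N - 2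
  end.

Definition Jshift (rt : RType) : nat :=
  match rt with TA | TCv => 1 | TB | TBv | TD => 2 | TC | TBC => 0 end.

(* The indices whose normalization constant is doubled. *)
Definition special (rt : RType) (N j : nat) : bool :=
  match rt with
  | TB | TBv => j == 1%N
  | TD => (j == 1%N) || (j == N)
  | _ => false
  end.

(** For a special index [j], the partner [n] with [omega j n = - omega j m]: [1 - m] when [j = 1],
    and [- m] for [j = N] in type D. It is only used together with [special]. *)
Definition opp_index (j : nat) (m : int) : int := if j == 1%N then 1 - m else - m.

(** Difference and sum of two frequencies [omega j n] and [omega k m] as integers: the half-integer
    parts combine to integers in both, so coincidences become integer equations. *)
Definition freq_sub rt N (j k : nat) (n m : int) : int :=
  (Ncal_nat rt N)%:Z * (n - m) + (j%:Z - k%:Z).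
Definition freq_add rt N (j k : nat) (n m : int) : int :=
  (Ncal_nat rt N)%:Z * (n + m - 1) + (j%:Z + k%:Z - (Jshift rt)%:Z).

(** A remainder argument with the upper end [b = a] included, since type D attains it. *)
Let mul_add_eq0 (a q b : int) : 0 < a -> a * q + b = 0 -> - a < b -> b <= a ->
  (q = 0 /\ b = 0) \/ (q = -1 /\ b = a).
Proof.
move=> a0 e b1 b2.
have q1 : -1 <= q by rewrite leNgt; apply/negP => h; nia.
have q2 : q <= 0 by rewrite leNgt; apply/negP => h; nia.
have [q0|q0] : q = 0 \/ q = -1 by lia.
  by left; split => //; move: e; rewrite q0 mulr0 add0r.
by right; split => //; move: e; rewrite q0; lia.
Qed.

Lemma leq_Ncal_nat rt N : (rt = TD -> (2 <= N)%N) -> (0 < N)%N -> (N <= Ncal_nat rt N)%N.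
Proof. by case: rt => /= h ?; try lia; have := h erefl; lia. Qed.

Section Index.
Variables (rt : RType) (N j k : nat).
Hypotheses (hD : rt = TD -> (2 <= N)%N) (j1 : (1 <= j <= N)%N) (k1 : (1 <= k <= N)%N).

(** The offset [j - k] is smaller than [N <= Ncal_nat rt N] in absolute value, so it cannot
    compensate a nonzero multiple of [Ncal_nat rt N]. *)
Lemma freq_sub_eq0 n m : (freq_sub rt N j k n m == 0) = (j == k) && (n == m).
Proof.
apply/eqP/andP => [h|[/eqP -> /eqP ->]]; last by rewrite /freq_sub !subrr mulr0.
have N0 : (0 < N)%N by lia.
have hN := leq_Ncal_nat rt N hD N0.
have [|||[h1 h2]|[h1 h2]] := mul_add_eq0 _ _ _ _ h; try by lia.
Qed.

(** The offset [j + k - Jshift] lies between [0] and [Ncal_nat]. It is [0] only for [j = k = 1] with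
    shift [2] (the B types and D), and it reaches [Ncal_nat] only for [j = k = N] in type D; these
    are the special indices. *)
Lemma freq_add_eq0 n m : rt <> TA ->
  (freq_add rt N j k n m == 0) = [&& j == k, special rt N j & n == opp_index j m].
Proof.
move=> rtA; have N0 : (0 < N)%N by lia.
have hN := leq_Ncal_nat rt N hD N0.
have e2 : (Jshift rt <= 2)%N by case: (rt).
have b2 : (j + k <= Ncal_nat rt N + Jshift rt)%N by case: rt hD rtA => //= h _; try lia; have := h erefl; lia.
apply/eqP/and3P => [h|[/eqP <- sp /eqP nE]].
  have [|||[h1 h2]|[h1 h2]] := mul_add_eq0 _ _ _ _ h; try by lia.
    have nE : n = 1 - m by lia.
    have [jE kE] : j = 1%N /\ k = 1%N by lia.
    have eE : Jshift rt = 2%N by lia.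
    by rewrite jE kE /opp_index nE; split => //; case: (rt) rtA eE.
  have rD : rt = TD by case: rt hD rtA h2 {h b2 h1} => //= *; lia.
  move: h1 h2 hN; rewrite rD /= => h1 h2 hN; have N2 := hD rD.
  have [jE kE] : j = N /\ k = N by lia.
  rewrite jE kE /opp_index; split => //; first by rewrite eqxx orbT.
  by apply/eqP; case: eqP => // ?; lia.
move: nE; rewrite /freq_add /opp_index.
case: eqP => [-> ->|j1' ->].
  have -> : Jshift rt = 2%N by case: (rt) rtA sp.
  lia.
have rD : rt = TD by case: (rt) rtA sp => //= _ /eqP.
move: sp; rewrite rD /= => /orP[/eqP//|/eqP ->]; have := hD rD; lia.
Qed.

End Index.
End RootSystems.

Lemma conjcM {R : realType} (a b : R[i]) : conjc (a * b) = conjc a * conjc b.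
Proof. by case: a b => [? ?] [? ?]; apply: eq_re_im => /=; ring. Qed.

(** * Fourier expansion of the functions [M_j] and their Gram integrals *)

Section Eigenfunctions.
Context {R : realType}.
Local Notation C := R[i].
Variables (rt : RType) (N : nat) (r : R).
Hypotheses (hD : rt = TD -> (2 <= N)%N) (N0 : (0 < N)%N) (hr : 0 < r).

Lemma Ncal_natE : Ncal rt N = (Ncal_nat rt N)%:R :> R.
Proof.
case: rt hD => //= h; last by rewrite natrB//; have := h erefl; lia.
by rewrite -subn1 natrB//; lia.
Qed.

Lemma Ncal_gt0 : 0 < Ncal rt N :> R.
Proof. by rewrite Ncal_natE ltr0n; apply: leq_trans N0 _; exact: leq_Ncal_nat. Qed.

Lemma JrE j : Jr rt j = j%:R - (Jshift rt)%:R / 2 :> R.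
Proof. by case: rt => /=; field. Qed.

(** Frequency in units of [1 / r]: the [2 * pi * r] of [xi] cancels, and [Ncal] clears the
    denominator of [Jr j / Ncal]. *)
Definition omega (j : nat) (n : int) : R := Ncal rt N * half_int n + Jr rt j.

Lemma omegaB j k n m : omega j n - omega k m = (freq_sub rt N j k n m)%:~R.
Proof.
rewrite /omega /freq_sub /half_int Ncal_natE !JrE !(intrD, intrM, rmorphB, rmorphN) /=.
by rewrite -!pmulrn; ring.
Qed.

Lemma omegaD j k n m : omega j n + omega k m = (freq_add rt N j k n m)%:~R.
Proof.
rewrite /omega /freq_add /half_int Ncal_natE !JrE !(intrD, intrM, rmorphB, rmorphN) /=.
by rewrite -!pmulrn; field.
Qed.

Definition eigf (j : nat) (n : int) (x : R) : C :=
  match rt with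
  | TA => cis (omega j n / r * x)
  | TB | TBv => (alt_sign n * sin (omega j n / r * x))%:C
  | TC | TCv | TBC => (sin (omega j n / r * x))%:C
  | TD => (cos (omega j n / r * x))%:C
  end.

Definition Theta_factor : C :=
  match rt with TA => 1 | TB | TBv => - 2 | TC | TCv | TBC => 2 * iC | TD => 2 end.

Definition im_tau (t : R) : R := Ncal rt N ^+ 2 * (t / (2 * pi * r ^+ 2)).

Lemma im_tauD t t' : im_tau (t + t') = im_tau t + im_tau t'.
Proof. by rewrite /im_tau mulrDl mulrDr. Qed.

Lemma im_tau_gt0 t : 0 < t -> 0 < im_tau t.
Proof.
move=> t0; have := Ncal_gt0 => n0; have := pi_gt0 R => p0.
by rewrite /im_tau mulr_gt0 ?exprn_gt0// divr_gt0// !mulr_gt0// exprn_gt0.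
Qed.

Lemma tautE t : (Ncal rt N ^+ 2)%:C * taut r t = 0 +i* im_tau t.
Proof. by apply: eq_re_im; rewrite ?reCM ?imCM /im_tau /=; ring. Qed.

Lemma MfunE j x t : 0 < t ->
  Mfun rt N r j x t = Theta_factor * theta_sum (im_tau t) (Jr rt j / Ncal rt N) (fun n => eigf j n x).
Proof.
move=> t0; have y0 := im_tau_gt0 t t0; rewrite /Mfun tautE.
have phE n : 2 * pi * (Ncal rt N * xi r x) * (half_int n + Jr rt j / Ncal rt N)
    = omega j n / r * x.
  have := Ncal_gt0; rewrite /xi /omega => n0.
  by move: (@pi R) (pi_gt0 R) => p p0; field; rewrite !gt_eqF.
rewrite /ThetaSharp /Theta_factor /eigf; case: rt phE => phE;
  rewrite ?ThetaAE ?ThetaBE ?ThetaCE ?ThetaDE// ?mul1r; congr (_ * theta_sum _ _ _) || congr (theta_sum _ _ _);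
  by apply/funext => n; rewrite phE.
Qed.

Lemma domC_eigf j x : domC (fun=> 1) (fun n => eigf j n x).
Proof.
rewrite /eigf; case: rt; try exact: domC_cis; apply: domC_real => n;
  by rewrite ?normrM ?norm_alt_sign ?mul1r ?cos_max ?sin_max.
Qed.

Lemma bmC_eigf j n : bmC (eigf j n).
Proof.
have bc (a : R) : bm (fun x : R => cos (a * x)) by exact: bm_cos.
have bs (a : R) : bm (fun x : R => sin (a * x)) by exact: bm_sin.
rewrite /eigf; case: rt; first by split; [exact: bc|exact: bs].
all: apply: bmC_real; try first [exact: bs|exact: bc].
all: by apply: bmM; [exact: bm_cst|exact: bs].
Qed.

Lemma conj_theta_sum y s (u : int -> C) : 0 < y -> domC (fun=> 1) u ->
  (conjc (theta_sum y s u)) = theta_sum y s (fun n => (conjc (u n))).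
Proof.
move=> y0 u1; apply: eq_re_im => /=.
  congr zsumR; apply/funext => n; case: (u n) => a b /=; ring.
have d : domC (theta_coef y s) (fun n => (theta_coef y s n)%:C * u n).
  by apply: domC_scale => // n; rewrite ltW// theta_coef_gt0.
rewrite -mulN1r -(zsumRZ (theta_coef y s))//; last first.
- by move=> n; case: (d n).
- exact: zsummable_theta_coef.
by congr zsumR; apply/funext => n; case: (u n) => a b /=; ring.
Qed.

Lemma domC_conj (c : int -> R) (u : int -> C) : domC c u -> domC c (fun n => (conjc (u n))).
Proof. by move=> uc n; have := uc n; case: (u n) => a b /=; rewrite normrN. Qed.

Lemma bmC_theta_sum y s (u : int -> R -> C) : 0 < y -> (forall n, bmC (u n)) ->
  (forall x, domC (fun=> 1) (u^~ x)) -> bmC (fun x => theta_sum y s (u^~ x)).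
Proof.
move=> y0 bu u1.
apply: (bmC_zsumC (theta_coef y s) (fun n x => (theta_coef y s n)%:C * u n x)).
- exact: zsummable_theta_coef.
- by move=> n; apply: bmCM => //; exact: bmC_cst.
- by move=> x; apply: domC_scale => // n; rewrite ltW// theta_coef_gt0.
Qed.

Lemma bmC_Mfun j t : 0 < t -> bmC (fun x => Mfun rt N r j x t).
Proof.
move=> t0; under eq_fun do rewrite MfunE//; apply: bmCM; first exact: bmC_cst.
apply: bmC_theta_sum; [exact: im_tau_gt0|exact: bmC_eigf|exact: domC_eigf].
Qed.

(** The length of the domain, halved outside type A by the product-to-sum formula. *)
Definition gram_weight : R := if rt is TA then 2 * pi * r else pi * r / 2.

Lemma RIC_real (g : R -> R) : RIC (Dom rt r) (fun x => (g x)%:C) = (RI (Dom rt r) g)%:C.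
Proof.
apply: eq_re_im => //=; rewrite RI_cst ?mul0r//; exact: measurable_Dom.
Qed.

Let alt_sign_sq n : alt_sign n * alt_sign n = 1 :> R.
Proof. by rewrite -expr2 -(real_normK (num_real _)) norm_alt_sign expr1n. Qed.

Let alt_sign_1B m : alt_sign (1 - m) * alt_sign m = -1 :> R.
Proof. by rewrite /alt_sign -expfzDr ?subrK ?oppr_eq0 ?oner_eq0// expr1z. Qed.

Let prod_sin (a b : R) : sin a * sin b = 2^-1 * (cos (a - b) + - 1 * cos (a + b)).
Proof. by rewrite cosB cosD; field. Qed.

Let prod_cos (a b : R) : cos a * cos b = 2^-1 * (cos (a - b) + 1 * cos (a + b)).
Proof. by rewrite cosB cosD; field. Qed.

Let RI_prod (j k : nat) (n m : int) (e w : R) : rt <> TA ->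
  RI (Dom rt r) (fun x => w * (2^-1 * (cos (omega j n / r * x - omega k m / r * x)
     + e * cos (omega j n / r * x + omega k m / r * x)))) =
  w * gram_weight * ((freq_sub rt N j k n m == 0)%:R + e * (freq_add rt N j k n m == 0)%:R).
Proof.
move=> rtA; have mD := measurable_Dom rt r; have fD := Dom_lty rt r.
rewrite (_ : (fun x => _) = fun x => w * (2^-1 * (cos ((freq_sub rt N j k n m)%:~R / r * x)
     + e * cos ((freq_add rt N j k n m)%:~R / r * x)))); last first.
  apply/funext => x; rewrite -omegaB -omegaD; do 2!congr (_ * _).
  by congr (cos _ + _ * cos _); ring.
set a := (freq_sub _ _ _ _ _ _)%:~R / r; set b := (freq_add _ _ _ _ _ _)%:~R / r.
have b1 : bm (fun x => cos (a * x)) := bm_cos a.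
have b2 : bm (fun x => cos (b * x)) := bm_cos b.
have b3 : bm (fun x => e * cos (b * x)) by apply: bmM => //; exact: bm_cst.
have b4 : bm (fun x => cos (a * x) + e * cos (b * x)) by exact: bmD.
have b5 : bm (fun x => 2^-1 * (cos (a * x) + e * cos (b * x))).
  by apply: bmM => //; exact: bm_cst.
rewrite RIZ// RIZ// RID// RIZ// !RI_cos_half//.
have -> : gram_weight = pi * r / 2 by rewrite /gram_weight; case: rt rtA.
by field.
Qed.

Lemma RIC_eigf j k n m : (1 <= j <= N)%N -> (1 <= k <= N)%N ->
  RIC (Dom rt r) (fun x => eigf j n x * (conjc (eigf k m x))) =
  ((j == k)%:R * gram_weight * (n == m)%:R +
   (j == k)%:R * gram_weight * (special rt N j)%:R * (n == opp_index j m)%:R)%:C.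
Proof.
move=> j1 k1; have dE := freq_sub_eq0 rt N j k hD j1 k1 n m.
have sE := freq_add_eq0 rt N j k hD j1 k1 n m.
have [rA|rtA] : rt = TA \/ rt <> TA by case: rt; [left|right..].
  have -> : special rt N j = false by rewrite rA.
  have -> : gram_weight = 2 * pi * r by rewrite /gram_weight rA.
  have eE l p x : eigf l p x = cis (omega l p / r * x) by rewrite /eigf rA.
  have -> : (fun x => eigf j n x * (conjc (eigf k m x))) =
      fun x => cis ((freq_sub rt N j k n m)%:~R / r * x).
    apply/funext => x; rewrite !eE conj_cis -cisD -omegaB.
    by congr cis; ring.
  have [cE sE'] := RI_trig_full r (freq_sub rt N j k n m) hr.
  rewrite -rA in cE sE'.
  apply: eq_re_im; rewrite /= ?sE' ?cE// dE -mulnb natrM; ring.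
have {}sE := sE rtA; have R1 := RI_prod j k n m.
(* [e] is the sign in the product-to-sum formula, [-1] for sines and [1] for cosines; [w] is the
   product of alternating signs in the B types and [1] otherwise. The reflection [m] to [1 - m]
   flips the alternating sign, so [w * e = 1] on the opposite pairs of the B types too; the types
   with shift [0] and C-vee have no special index. *)
suff [e [w [E [H1 H2]]]] : exists e w : R, [/\
  (fun x => eigf j n x * (conjc (eigf k m x))) = (fun x =>
   (w * (2^-1 * (cos (omega j n / r * x - omega k m / r * x)
     + e * cos (omega j n / r * x + omega k m / r * x))))%:C),
  w * (n == m)%:R = (n == m)%:R &
  special rt N j -> w * e * (n == opp_index j m)%:R = (n == opp_index j m)%:R].
  rewrite E RIC_real R1// dE sE -!mulnb !natrM; congr (_%:C).
  transitivity ((j == k)%:R * gram_weight * (w * (n == m)%:R) + (j == k)%:R * gram_weight *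
    ((special rt N j)%:R * (w * e * (n == opp_index j m)%:R))); first by ring.
  by rewrite H1; case: (special rt N j) H2 => [->//|_] /=; ring.
have cr (a b : R) : a%:C * (conjc (b%:C)) = (a * b)%:C.
  by apply: eq_re_im => /=; ring.
have eqm : alt_sign n * alt_sign m * (n == m)%:R = (n == m)%:R :> R.
  by case: eqP => [->|_]; rewrite ?mulr0// alt_sign_sq mulr1.
rewrite /eigf; case: rt rtA => // _.
- exists (-1), (alt_sign n * alt_sign m); split => //.
    by apply/funext => x; rewrite cr -prod_sin; congr (_%:C); ring.
  move=> /= /eqP ->; rewrite /opp_index /=; case: eqP => [->|_]; rewrite ?mulr0//.
  by rewrite alt_sign_1B; ring.
- exists (-1), (alt_sign n * alt_sign m); split => //.
    by apply/funext => x; rewrite cr -prod_sin; congr (_%:C); ring.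
  move=> /= /eqP ->; rewrite /opp_index /=; case: eqP => [->|_]; rewrite ?mulr0//.
  by rewrite alt_sign_1B; ring.
- by exists (-1), 1; split; rewrite ?mul1r//; apply/funext => x; rewrite cr -prod_sin mul1r.
- by exists (-1), 1; split; rewrite ?mul1r//; apply/funext => x; rewrite cr -prod_sin mul1r.
- by exists (-1), 1; split; rewrite ?mul1r//; apply/funext => x; rewrite cr -prod_sin mul1r.
- exists 1, 1; split; rewrite ?mul1r//.
  by apply/funext => x; rewrite cr -prod_cos mul1r.
Qed.

Definition Theta_factor_sqnorm : R := if rt is TA then 1 else 4.

Lemma Theta_factor_conj : Theta_factor * conjc Theta_factor = Theta_factor_sqnorm%:C.
Proof.
by rewrite /Theta_factor /Theta_factor_sqnorm -[2 : C](rmorph_nat (@real_complex R));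
  case: rt; apply: eq_re_im => /=; ring.
Qed.

Let coef_sum j (t : R) := zsumR (theta_coef (im_tau t) (Jr rt j / Ncal rt N)).

(** With [s = Jr j / Ncal], the exponent of [theta_coef] depends on [n] through
    [(half_int n + s) ^+ 2] alone, and [opp_index] negates [half_int n + s]: [s = 0] for [j = 1],
    and [s = 1/2] for [j = N] in type D. *)
Lemma theta_coef_rho j (y : R) m : (special rt N j)%:R * theta_coef y (Jr rt j / Ncal rt N) (opp_index j m) =
  (special rt N j)%:R * theta_coef y (Jr rt j / Ncal rt N) m.
Proof.
case sp: (special rt N j); last by rewrite !mul0r.
congr (_ * expR (- (_ * _))).
rewrite /opp_index; case: eqP => jE.
  have -> : Jr rt j = 0 :> R.
    by rewrite JrE jE; case: rt sp => // _; rewrite /=; field.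
  by rewrite mul0r /half_int rmorphB /=; field.
have [rD jN] : rt = TD /\ j = N.
  by move: sp; case: rt => //=; do ?[by move=> /eqP|move=> /orP[/eqP//|/eqP ->]].
have N2 := hD rD.
have -> : Jr rt j / Ncal rt N = 2^-1 :> R.
  have : 2 <= N%:R :> R by rewrite ler_nat.
  by rewrite rD jN /= => h; rewrite natrM; field; rewrite gt_eqF//; lra.
by rewrite /half_int rmorphN /=; field.
Qed.

Lemma RIC_Mfun j k t t' : (1 <= j <= N)%N -> (1 <= k <= N)%N -> 0 < t -> 0 < t' ->
  RIC (Dom rt r) (fun x => Mfun rt N r j x t * (conjc (Mfun rt N r k x t'))) =
  ((j == k)%:R * (Theta_factor_sqnorm * (gram_weight + gram_weight * (special rt N j)%:R) * coef_sum j (t + t')))%:C.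
Proof.
move=> j1 k1 t0 t0'; have mD := measurable_Dom rt r; have fD := Dom_lty rt r.
have y0 := im_tau_gt0 _ t0; have y0' := im_tau_gt0 _ t0'.
pose Ft y l x := theta_sum y (Jr rt l / Ncal rt N) (fun n => eigf l n x).
pose Gt y l x := theta_sum y (Jr rt l / Ncal rt N) (fun n => (conjc (eigf l n x))).
have bFG : bmC (fun x => Ft (im_tau t) j x * Gt (im_tau t') k x).
  apply: bmCM; apply: bmC_theta_sum => //.
  - by move=> n; exact: bmC_eigf.
  - by move=> x; exact: domC_eigf.
  - by move=> n; apply: bmC_conj; exact: bmC_eigf.
  - by move=> x; apply: domC_conj; exact: domC_eigf.
rewrite (_ : (fun x => _) = fun x => (Theta_factor * conjc Theta_factor) * (Ft (im_tau t) j x * Gt (im_tau t') k x)).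
  rewrite RICZ// Theta_factor_conj /Ft /Gt /theta_sum.
  have s0 := zsummable_theta_coef (im_tau t) (Jr rt j / Ncal rt N) y0.
  have s0' := zsummable_theta_coef (im_tau t') (Jr rt k / Ncal rt N) y0'.
  rewrite (RIC_zsumC_mul _ mD fD _ _ (eigf j) (fun n x => conjc (eigf k n x))
    ((j == k)%:R * gram_weight) ((j == k)%:R * gram_weight * (special rt N j)%:R) (opp_index j))//.
  - rewrite -rmorphM; congr (_%:C).
    have [<-|jk] := eqVneq j k; last by rewrite /=; ring.
    rewrite /coef_sum (_ : (fun n => _ * _) = theta_coef (im_tau (t + t')) (Jr rt j / Ncal rt N)).
      by rewrite /=; ring.
    by apply/funext => n; rewrite theta_coefM -im_tauD.
  - by move=> n; exact: bmC_eigf.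
  - by move=> n; apply: bmC_conj; exact: bmC_eigf.
  - by move=> x; exact: domC_eigf.
  - by move=> x; apply: domC_conj; exact: domC_eigf.
  - by move=> n m; exact: RIC_eigf.
  - by move=> m; rewrite -!mulrA theta_coef_rho.
apply/funext => x; rewrite !MfunE// /Gt -conj_theta_sum//; last exact: domC_eigf.
by rewrite conjcM /Ft; ring.
Qed.

Lemma coef_sum_gt0 j t : 0 < t -> 0 < coef_sum j t.
Proof.
move=> t0; apply: zsumR_gt0; last by move=> n; exact: theta_coef_gt0.
exact/zsummable_theta_coef/im_tau_gt0.
Qed.

Lemma mconstE j t : 0 < t -> (1 <= j <= N)%N -> mconst rt N r t j =
  (Theta_factor_sqnorm * (gram_weight + gram_weight * (special rt N j)%:R) * coef_sum j t)%:C.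
Proof.
move=> t0 j1; have y0 := im_tau_gt0 _ t0; have n0 := Ncal_gt0.
have gE (l : nat) : theta2 ((Ncal rt N * Jr rt l)%:C * taut r t)
    ((Ncal rt N ^+ 2)%:C * taut r t) = (coef_sum l t)%:C.
  (* This exhibits the argument of [theta2] as [s] times its modulus, with the same [s] as in the
     expansion of [M_l]. *)
  have -> : (Ncal rt N * Jr rt l)%:C * taut r t =
      (Jr rt l / Ncal rt N)%:C * ((Ncal rt N ^+ 2)%:C * taut r t).
    rewrite mulrA -rmorphM; congr ((_ : R)%:C * _).
    by move: (Ncal rt N) n0 => p p0; field; rewrite gt_eqF.
  by rewrite tautE theta2_real.
have J1 : (Jshift rt = 2)%N -> Jr rt 1 = 0 :> R by move=> e; rewrite JrE e; field.
have g1 : (Jshift rt = 2)%N ->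
    theta2 0 ((Ncal rt N ^+ 2)%:C * taut r t) = (coef_sum 1 t)%:C.
  by move=> e; rewrite -gE J1// mulr0 rmorph0 mul0r.
(* The two cases agree: [1] times [2 * pi * r] in type A, and [4] times [pi * r / 2] otherwise.
   Special indices double this to [4 * pi * r]. *)
have alE : Theta_factor_sqnorm * gram_weight = 2 * pi * r by rewrite /Theta_factor_sqnorm /gram_weight; case: rt; field.
have gen : special rt N j = false -> (2 * pi * r)%:C * (coef_sum j t)%:C =
    (Theta_factor_sqnorm * (gram_weight + gram_weight * (special rt N j)%:R) * coef_sum j t)%:C.
  by move=> ->; rewrite -rmorphM -alE mulr0n mulr0 addr0.
have dbl : special rt N j = true -> (4 * pi * r)%:C * (coef_sum j t)%:C =
    (Theta_factor_sqnorm * (gram_weight + gram_weight * (special rt N j)%:R) * coef_sum j t)%:C.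
  move=> ->; rewrite -rmorphM (_ : 4 * pi * r = 2 * (Theta_factor_sqnorm * gram_weight)); last first.
    by rewrite alE; ring.
  by congr (_%:C); rewrite mulr1n mulr1; ring.
have gN : rt = TD -> theta2 ((Ncal rt N * (N%:R - 1))%:C * taut r t)
    ((Ncal rt N ^+ 2)%:C * taut r t) = (coef_sum N t)%:C.
  by move=> rD; rewrite -gE rD.
move: gen dbl g1 gN (gE j); move: (Theta_factor_sqnorm * _ * _)%:C => V.
rewrite /mconst /special; case: rt => gen dbl g1 gN gj; rewrite ?gj ?(g1 erefl);
  try exact: gen.
- by case: eqP gen dbl => [-> _ ->|_ ->].
- by case: eqP gen dbl => [-> _ ->|_ ->].
- case: eqP gen dbl => [-> _ ->//|_] /=; rewrite gN//.
  by case: eqP => [-> _ ->|_ ->].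
Qed.

Lemma mconst_neq0 j t : 0 < t -> (1 <= j <= N)%N -> mconst rt N r t j != 0.
Proof.
move=> t0 j1; rewrite mconstE//.
have c0 := coef_sum_gt0 j _ t0; have p0 := pi_gt0 R.
have k0 : 0 < Theta_factor_sqnorm by rewrite /Theta_factor_sqnorm; case: rt.
have a0 : 0 < gram_weight by rewrite /gram_weight; case: rt; rewrite ?divr_gt0// !mulr_gt0.
have s0 : 0 <= gram_weight * (special rt N j)%:R by rewrite mulr_ge0// ltW.
have : 0 < Theta_factor_sqnorm * (gram_weight + gram_weight * (special rt N j)%:R) * coef_sum j t.
  by rewrite !mulr_gt0// ltr_pwDl.
by move: (Theta_factor_sqnorm * _ * _) => V V0; rewrite (fmorph_eq0 (@real_complex R)) gt_eqF.
Qed.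

Lemma RIC_Mfun_mconst j k ts t : (1 <= j <= N)%N -> (1 <= k <= N)%N ->
  0 < t -> t < ts ->
  RIC (Dom rt r) (fun x => Mfun rt N r j x t * conjc (Mfun rt N r k x (ts - t))) =
  (j == k)%:R * mconst rt N r ts j.
Proof.
move=> j1 k1 t0 tts; have t0' : 0 < ts - t by rewrite subr_gt0.
rewrite RIC_Mfun// mconstE ?(lt_trans t0)// subrKC [LHS]rmorphM; congr (_ * _).
exact: rmorph_nat.
Qed.

End Eigenfunctions.

(** The domain factor is absorbed by [dintC], while the ordering factor stays in the integrand to be
    symmetrized. *)
Lemma SN_indic {R : realType} (rt : RType) (N : nat) (r : R) (x : N.-tuple R) :
  \1_(SN rt N r) x = \1_(Dpow (Dom rt r) N) x * \1_(incr N) x :> R.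
Proof.
rewrite !indicE -natrM mulnb; congr (_%:R); congr (nat_of_bool _).
apply/idP/andP => [/set_mem[h1 h2]|[/set_mem h1 /set_mem h2]].
  by split; apply/mem_set.
by apply/mem_set; split.
Qed.

Theorem theorem3p3 (R : realType) (rt : RType) (N : nat)
  (hD : rt = TD -> (2 <= N)%N) (r ts t : R)
  (hr : 0 < r) (hts : 0 < ts) (ht0 : 0 < t) (hts' : t < ts)
  (d : measure_display) (Omega : measurableType d) (P : probability Omega R)
  (X : Omega -> N.-tuple R) (mX : measurable_fun setT X)
  (lawX : forall A : set (N.-tuple R), measurable A ->
     (fine (P (X @^-1` A)))%:C = iintC N (fun x => (\1_A x)%:C * pdens rt N r ts t x)) :
  forall n : nat, (1 <= n <= N)%N ->
  forall f : n.-tuple R -> R, measurable_fun setT f ->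
  (exists M : R, forall x, `|f x| <= M) ->
  (Rintegral P setT
     (fun w => \sum_(j : n.-tuple 'I_N | uniq j)
                 f (map_tuple (fun i => tnth (X w) i) j)))%:C
  = iintC n (fun x =>
      (\1_[set y : n.-tuple R | forall a : 'I_n, Dom rt r (tnth y a)] x)%:C
      * (f x)%:C
      * \det (\matrix_(a < n, b < n) Kker rt N r ts t (tnth x a) (tnth x b))).
Proof.
move=> n /andP[n1 nN] f mf [B fB].
have N0 : (0 < N)%N by exact: leq_trans nN.
have t0' : 0 < ts - t by rewrite subr_gt0.
have bf : bm f by split => //; exists B.
have mD := measurable_Dom rt r; have fD := Dom_lty rt r.
pose m (i : 'I_N) := mconst rt N r ts i.+1.
(* All normalization goes into [phi], so that [kern] is literally [Kker]. *)
pose phi (i : 'I_N) (x : R) := (m i)^-1 * Mfun rt N r i.+1 x t.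
pose psi (i : 'I_N) (y : R) := conjc (Mfun rt N r i.+1 y (ts - t)).
have iN (i : 'I_N) : (1 <= i.+1 <= N)%N by rewrite /= ltn_ord.
have m0 i : m i != 0 by exact: mconst_neq0.
have bM (i : 'I_N) s : 0 < s -> bmC (fun x => Mfun rt N r i.+1 x s).
  by move=> s0; exact: bmC_Mfun.
have bphi i : bmC (phi i) by apply: bmCM; [exact: bmC_cst|exact: bM].
have bpsi i : bmC (psi i) by apply: bmC_conj; exact: bM.
have biorth i j : RIC (Dom rt r) (fun y => phi i y * psi j y) = (i == j)%:R.
  rewrite (_ : (fun y => _) = fun y => (m i)^-1 *
      (Mfun rt N r i.+1 y t * conjc (Mfun rt N r j.+1 y (ts - t)))).
    rewrite RICZ//; last by apply: bmCM; [exact: bM|exact: bpsi].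
    by rewrite RIC_Mfun_mconst// mulrCA -/(m i) mulVf// mulr1 eqSS.
  by apply/funext => y; rewrite mulrA.
have KE x y : Kker rt N r ts t x y = kern N phi psi x y by [].
have law' (A : set (N.-tuple R)) : measurable A -> (fine (P (X @^-1` A)))%:C =
    dintC (Dom rt r) N (fun x => (\1_A x)%:C *
      ((\1_(incr N) x)%:C * \det (kern_mx N phi psi N x))).
  move=> mA; rewrite lawX// -iintC_dintC; congr iintC; apply/funext => x.
  rewrite /pdens SN_indic rmorphM.
  suff -> : qdens rt N r ts t x / mprod rt N r ts = \det (kern_mx N phi psi N x).
    by rewrite /=; ring.
  rewrite det_kern_mxE /qdens -mulrA; congr (_ * _).
  (* Dividing the density by the product of the constants scales row [l] of one determinant by the
     inverse of [m l]. *)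
  have -> : \matrix_(l < N, k < N) phi l (tnth x k) =
      diag_mx (\row_l (m l)^-1) *m \matrix_(l < N, k < N) Mfun rt N r l.+1 (tnth x k) t.
    by apply/matrixP => a b; rewrite mul_diag_mx !mxE.
  rewrite det_mulmx det_diag mulrC; congr (_ * _).
  rewrite /mprod -prodfV; apply: eq_bigr => i _; by rewrite mxE.
have := correlationE (Dom rt r) mD fD N P X mX phi psi bphi bpsi biorth law' n f nN bf.
rewrite /correlation => ->; rewrite -iintC_dintC; congr iintC; apply/funext => x.
by rewrite mulrA.
Qed.
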